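(* There exists a stationary Gaussian process $(X_t)_{t\in\mathbb{R}}$ (real-valued) whose set of weak local Markov transforms is exactly the set of all processes $(Y_t)_{t\in\mathbb{R}}$ satisfying: 1. the process $(Y_t)_{t\in\mathbb{R}}$ is centered Gaussian with constant variance function equal to $1$; 2. the covariance function of $(Y_t)_{t\in\mathbb{R}}$ is non-negative; 3. the process $(Y_t)_{t\in\mathbb{R}}$ is Markov.
   Context: All notions depend only on laws of processes. For a probability measure $P$ on $\mathbb{R}^{T}$ ($T\subset\mathbb{R}$, cylindrical $\sigma$-algebra) and $t_1<\dots<t_m$ in $T$, $P^{t_1,\dots,t_m}$ is the image of $P$ under the projection onto the coordinates $t_1,\dots,t_m$. Concatenation and composition: let $P_i$ ($1\le i\le p-1$) be probability measures on $E_i\times E_{i+1}$ ($E_i$ Polish), the second marginal of $P_i$ being the first marginal of $P_{i+1}$; disintegrate $P_i(dx_i,dx_{i+1})=\mu_i(dx_i)k^i(x_i,dx_{i+1})$. The concatenation $P_1\circ\dots\circ P_{p-1}$ is the measure $\mu_1(dx_1)k^1(x_1,dx_2)\cdots k^{p-1}(x_{p-1},dx_p)$ on $E_1\times\dots\times E_p$, and the composition $P_1\cdot\ldots\cdot P_{p-1}$ is its image under $(x_1,\dots,x_p)\mapsto(x_1,x_p)$. $P$ is a Markov measure if $P^{t_1,\dots,t_m}=P^{t_1,t_2}\circ\dots\circ P^{t_{m-1},t_m}$ for all $t_1<\dots<t_m$ in $T$ (equivalently, $P$ is the law of a Markov process). For $s<t$, $\mathcal{S}_{[s,t]}$ is the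 set of finite sequences $R=(t_1<\dots<t_m)$ with $t_1=s$, $t_m=t$; $\sigma_R=\max_i|t_{i+1}-t_i|$; and $P^{s,t}_{\{R\}}:=P^{t_1,t_2}\cdot\ldots\cdot P^{t_{m-1},t_m}$. Weak local Markov transform: a Markov measure $P'$ on $\mathbb{R}^T$ ($T$ an interval) is a weak local Markov transform of $P$ if for all $s<t$ in $T$ there exists a sequence $(R_n)_{n\ge1}$ in $\mathcal{S}_{[s,t]}$ with $\sigma_{R_n}\to0$ and $P^{s,t}_{\{R_n\}}\to P'^{s,t}$ weakly. A process $Y$ is a weak local Markov transform of a process $X$ if the law of $Y$ is a weak local Markov transform of the law of $X$. *)

(* Defs.v *)
From HB Require Import structures.
From mathcomp Require Import all_boot all_order all_algebra.
From mathcomp Require Import all_classical all_reals all_analysis.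

Set Implicit Arguments.
Unset Strict Implicit.
Unset Printing Implicit Defensive.

Import Order.TTheory GRing.Theory Num.Theory.
Import numFieldNormedType.Exports.

Local Open Scope classical_set_scope.
Local Open Scope ring_scope.

(* The space R^T of real paths for the time set T = R, with the cylindrical
   sigma-algebra (the one generated by the coordinate maps). *)
Section path_space.
Variable R : realType.

Definition cylinders : set (set (R -> R)) :=
  [set C | exists t : R, exists2 A : set R,
    measurable A & C = [set w : R -> R | A (w t)]].

Definition path_space := g_sigma_algebraType cylinders.

Definition coord (t : R) (w : path_space) : R := (w : R -> R) t.

Lemma measurable_coord (t : R) : measurable_fun [set: path_space] (coord t).
Proof.
move=> _ A mA; rewrite setTI; apply: sub_sigma_algebra.
by exists t, A.
Qed.

Lemma measurable_fun_path d (S : measurableType d) (f : S -> path_space) :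
  (forall t, measurable_fun [set: S] (coord t \o f)) ->
  measurable_fun [set: S] f.
Proof.
move=> mf; apply: (@measurability _ _ S path_space setT f cylinders) => //.
move=> _ [_ [t [A mA ->]] <-].
exact: (mf t measurableT A mA).
Qed.

Definition coords n (t : n.-tuple R) (w : path_space) : n.-tuple R :=
  [tuple coord (tnth t i) w | i < n].

Lemma measurable_coords n (t : n.-tuple R) :
  measurable_fun [set: path_space] (coords t).
Proof.
apply/measurable_fun_tnthP => i.
rewrite (_ : _ \o _ = coord (tnth t i)); first exact: measurable_coord.
by apply/funext => w /=; rewrite tnth_mktuple.
Qed.

HB.instance Definition _ n (t : n.-tuple R) :=
  isMeasurableFun.Build _ _ _ _ (coords t) (measurable_coords t).

Definition coords2 (s t : R) (w : path_space) : R * R := (coord s w, coord t w).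

Lemma measurable_coords2 (s t : R) :
  measurable_fun [set: path_space] (coords2 s t).
Proof.
by apply: measurable_fun_pair; exact: measurable_coord.
Qed.

HB.instance Definition _ (s t : R) :=
  isMeasurableFun.Build _ _ _ _ (coords2 s t) (measurable_coords2 s t).

(* The marginals P^{t_1, ..., t_n}, as a law on n-tuples, and P^{s, t}, as a
   law on R * R. *)
Definition marginal (P : probability path_space R) n (t : n.-tuple R) :
  probability (n.-tuple R) R := distribution P (coords t).

Definition marginal2 (P : probability path_space R) (s t : R) :
  probability (R * R)%type R := distribution P (coords2 s t).

End path_space.

Section concatenation.
Variable R : realType.
Local Open Scope ereal_scope.

(* P(dx, dy) = mu(dx) k(x, dy), where mu is the first marginal of P *)
Definition disintegrates (P : probability (R * R)%type R) (k : R.-pker R ~> R) :=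
  forall A : set (R * R), measurable A ->
    P A = \int[pushforward P fst]_x \int[k x]_y (\1_A (x, y))%:E.

(* the integral of f(x_1, ..., x_n) against k_0(x, dx_1) k_1(x_1, dx_2) ...
   k_{n-1}(x_{n-1}, dx_n) *)
Fixpoint kernel_integral n :
    ('I_n -> R.-pker R ~> R) -> R -> (n.-tuple R -> \bar R) -> \bar R :=
  if n is n'.+1 then fun k x f =>
    \int[k ord0 x]_y
      kernel_integral (fun i => k (lift ord0 i)) y (fun v => f (cons_tuple y v))
  else fun _ _ f => f [tuple].

(* Q is the concatenation of the n.+1 laws Ps i. The kernels are only unique up
   to null sets; Q does not depend on their choice as soon as the second
   marginal of each law is the first marginal of the next one, which always
   holds for successive marginals of a law on the path space. *)
Definition is_concatenation n (Ps : 'I_n.+1 -> probability (R * R)%type R)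
    (Q : probability (n.+2.-tuple R) R) :=
  exists k : 'I_n.+1 -> R.-pker R ~> R,
    (forall i, disintegrates (Ps i) (k i)) /\
    (forall B : set (n.+2.-tuple R), measurable B ->
      Q B = \int[pushforward (Ps ord0) fst]_x
        kernel_integral k x (fun v => (\1_B (cons_tuple x v))%:E)).

Definition is_composition n (Ps : 'I_n.+1 -> probability (R * R)%type R)
    (Q : probability (R * R)%type R) :=
  exists2 C : probability (n.+2.-tuple R) R, is_concatenation Ps C &
    forall A : set (R * R), measurable A ->
      Q A = C [set x | A (tnth x ord0, tnth x ord_max)].

End concatenation.

Section markov.
Variable R : realType.

(* the laws P^{t_i, t_{i+1}} for consecutive entries of t *)
Definition successive_marginals (P : probability (path_space R) R) n
    (t : n.+2.-tuple R) (i : 'I_n.+1) : probability (R * R)%type R :=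
  marginal2 P t`_i t`_i.+1.

Definition markov_measure (P : probability (path_space R) R) :=
  forall n (t : n.+2.-tuple R), sorted <%R t ->
    is_concatenation (successive_marginals P t) (marginal P t).

(* t belongs to S_[a, b] *)
Definition subdivision (a b : R) n (t : n.+2.-tuple R) :=
  [/\ sorted <%R t, tnth t ord0 = a & tnth t ord_max = b].

Definition mesh n (t : n.+2.-tuple R) : R :=
  \big[Num.max/0]_(i < n.+1) `|t`_i.+1 - t`_i|.

Definition weak_cvg (Q_ : nat -> probability (R * R)%type R)
    (Q : probability (R * R)%type R) :=
  forall f : R * R -> R, continuous f -> (exists M, forall x, `|f x| <= M) ->
    (fun n => \int[Q_ n]_x (f x)%:E)%E @ \oo --> (\int[Q]_x (f x)%:E)%E.

Definition weak_local_markov_transform (P P' : probability (path_space R) R) :=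
  markov_measure P' /\
  forall a b : R, a < b ->
    exists (m : nat -> nat) (t : forall n, (m n).+2.-tuple R)
           (Q : nat -> probability (R * R)%type R),
      [/\ forall n, subdivision a b (t n),
          (fun n => mesh (t n)) @ \oo --> (0 : R),
          forall n, is_composition (successive_marginals P (t n)) (Q n) &
          weak_cvg Q (marginal2 P' a b)].

End markov.

Section process.
Context d (T : measurableType d) (R : realType) (P : probability T R).

Definition path_of (X : R -> {RV P >-> R}) (w : T) : path_space R :=
  fun t : R => X t w.

Lemma measurable_path_of (X : R -> {RV P >-> R}) :
  measurable_fun [set: T] (path_of X).
Proof.
apply: measurable_fun_path => t.
exact: (measurable_funPT (X t)).
Qed.

HB.instance Definition _ (X : R -> {RV P >-> R}) :=
  isMeasurableFun.Build _ _ _ _ (path_of X) (measurable_path_of X).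

Definition process_law (X : R -> {RV P >-> R}) : probability (path_space R) R :=
  distribution P (path_of X).

(* normal_prob m 0 is the uniform law on [0, 1], hence the separate treatment
   of degenerate Gaussian laws *)
Definition gaussian_law (mu : set R -> \bar R) :=
  exists m s : R, forall A : set R, measurable A ->
    mu A = if s == 0 then \d_m A else normal_prob m s A.

Definition gaussian_process (X : R -> {RV P >-> R}) :=
  forall n (t a : 'I_n -> R),
    gaussian_law (pushforward P (fun w => \sum_(i < n) a i * X (t i) w)).

Definition stationary (X : R -> {RV P >-> R}) :=
  forall (h : R) (A : set (path_space R)), measurable A ->
    process_law (fun t => X (t + h)) A = process_law X A.

Definition markov_process (X : R -> {RV P >-> R}) :=
  markov_measure (process_law X).

End process.

(* Main.v *)
Require Import Defs.
From HB Require Import structures.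
From mathcomp Require Import all_boot all_order all_algebra.
From mathcomp Require Import all_classical all_reals all_analysis.
From mathcomp Require Import ring lra measurable_realfun.
Import Order.TTheory GRing.Theory Num.Theory.
Import numFieldNormedType.Exports.
Local Open Scope classical_set_scope.
Local Open Scope ring_scope.

Set Implicit Arguments.
Unset Strict Implicit.
Unset Printing Implicit Defensive.

(** Let [phi : R -> rat] be additive with dense fibres (a Q-linear projection
    onto the line [Q pi]), and, for independent standard normal z, x and y, put
      X_t = (z + x cos (phi t) + y sin (phi t)) / sqrt 2.
    This process is stationary Gaussian with unit variance and covariance
    K h = (1 + cos (phi h)) / 2 in [0, 1]. Composing standard bivariate
    Gaussian laws multiplies their correlations, so that along a subdivision of
    [a, b] the composed law is the Gaussian one of correlation the product of
    the K (t_(i+1) - t_i), and the two-dimensional laws of a transform are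
    bivariate Gaussian with correlation in [0, 1]; the Markov property then
    makes the whole process Gaussian. Conversely, the values
    [phi t_1, phi t_2, ...] can be prescribed arbitrarily at points as close as
    we please to given ones: a first short step of angle [theta] followed by n
    steps of angle O(1/n) yields a product tending to (1 + cos theta) / 2, and
    every correlation in [0, 1] is such a limit. *)

(** * An additive function with dense fibres *)

(** If the angle were a continuous additive function of time, K h would be 1 - O(h^2) and the
    products along fine subdivisions would all tend to 1. Correlations below 1 appear only because
    arbitrarily short steps may carry a macroscopic angle. The total angle phi b - phi a is imposed,
    but the other n steps can absorb whatever the first one leaves: an angle of order 1/n costs a
    factor 1 - O(1/n^2), so this correction is free in the limit. The summand z turns the
    correlation cos into (1 + cos) / 2; without it, products and their limits could be negative,
    against the second condition on the transforms. Two obstacles shape the rest. Disintegration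
    kernels are defined only almost everywhere, so composed laws must be shown independent of their
    choice; this rests on the standard normal law being invariant under all the Gaussian kernels.
    And laws on the plane must be recognised from the laws of linear forms. *)

Section rational_valued_additive.
Variable R : realType.

(** A rational subspace maximal among those that contain 1 and avoid [x0] is a complement of the
    line spanned by [x0]: adding any further [y] must capture [x0], and the resulting relation can
    be solved for [y]. Containing 1, the subspace contains all rationals, hence is dense. *)
Lemma maximal_rat_subspace (x0 : R) : ~ rational x0 ->
  exists A : set R, [/\ ~ A x0, A 1,
    (forall q x y, A x -> A y -> A (ratr q * x + y)) &
    forall y, exists q, A (y - ratr q * x0)].
Proof.
move=> ix0.
(* [A 1] is required of nonempty sets only: Zorn's lemma is also applied to the
   empty chain, whose union is empty. *)
pose good (A : set R) := [/\ ~ A x0, (forall x, A x -> A 1) &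
  forall q x y, A x -> A y -> A (ratr q * x + y)].
have [|A [[nA A1 Aq] Amax]] := @Zorn_bigcup R good.
  move=> F Fg Ft; split.
  - by move=> [B FB]; case: (Fg _ FB).
  - by move=> x [B FB Bx]; exists B => //; case: (Fg _ FB) => _ + _; apply; exact: Bx.
  - move=> q x y [B FB Bx] [C FC Cy]; have [BC|CB] := Ft _ _ FB FC.
      by exists C => //; case: (Fg _ FC) => _ _; apply => //; exact: BC.
    by exists B => //; case: (Fg _ FB) => _ _; apply => //; exact: CB.
have {}A1 : A 1.
  apply: contrapT => nA1.
  have A0 : A = set0 by rewrite -subset0 => x /A1.
  (* The empty set is [good] but not maximal: the rationals form a larger good set, since [x0] is
     irrational. *)
  apply: (Amax rational).
    by rewrite A0 properEneq; split => //; apply/eqP => /seteqP[_ /(_ 0)]; apply; exists 0 => //; rewrite rmorph0.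
  split => //; first by move=> _ _; exists 1 => //; rewrite rmorph1.
  move=> q _ _ [x _ <-] [y _ <-]; exists (q * x + y) => //.
  by rewrite rmorphD rmorphM.
have A0 : A 0 by have := Aq (-1) _ _ A1 A1; rewrite rmorphN1 mulN1r addNr.
have AZ q x : A x -> A (ratr q * x) by move=> Ax; rewrite -[X in A X]addr0; exact: Aq.
exists A; split => // y.
have [Ay|nAy] := pselect (A y); first by exists 0; rewrite rmorph0 mul0r subr0.
pose B := [set z | exists r, A (z - ratr r * y)].
have AB : A `<=` B by move=> z Az; exists 0; rewrite rmorph0 mul0r subr0.
have By : B y by exists 1; rewrite rmorph1 mul1r subrr.
have [[r Ar]|nB] := pselect (B x0).
  have r0 : ratr r != 0 :> R.
    by apply/eqP => r0; apply: nA; move: Ar; rewrite r0 mul0r subr0.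
  exists r^-1.
  rewrite (_ : _ - _ = ratr (- r^-1) * (x0 - ratr r * y)); first exact: AZ.
  by rewrite rmorphN fmorphV; field.
exfalso; apply: (Amax B).
  by rewrite properEneq; split => //; apply/eqP => AeB; apply: nAy; rewrite AeB.
split => //; first by move=> _ _; exact: AB.
move=> q x z [r1 A1'] [r2 A2]; exists (q * r1 + r2).
rewrite (_ : _ - _ = ratr q * (x - ratr r1 * y) + (z - ratr r2 * y)); first exact: Aq.
by rewrite rmorphD rmorphM; ring.
Qed.

(** [phi y] is the coefficient of pi in the decomposition of [y] along [A] and the rational line of
    pi. The fibre over [q] is the translate of [A] by q pi, dense because [A] contains the
    rationals. *)
Lemma additive_dense_fibers : exists phi : R -> rat,
  (forall x y, phi (x + y) = phi x + phi y) /\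
  (forall q x y, x < y -> exists2 u, x < u < y & phi u = q).
Proof.
have [A [nA A1 Aq Ay]] := maximal_rat_subspace (@pi_irrationnal R).
have [phi phiP] := choice Ay.
(* Two distinct coefficients for the same [y] would put a nonzero rational multiple of pi in [A],
   hence pi itself. *)
have phiE q y : A (y - ratr q * pi) -> phi y = q.
  move=> Aqy; apply: contrapT => /eqP nq; apply: nA.
  have d0 : ratr (phi y) - ratr q != 0 :> R by rewrite subr_eq0 (inj_eq (@fmorph_inj _ _ _)).
  have A0 : A 0 by have := Aq (-1) _ _ A1 A1; rewrite rmorphN1 mulN1r addNr.
  rewrite -[pi]addr0 (_ : pi = ratr (phi y - q)^-1 * ((y - ratr q * pi) + ratr (-1) * (y - ratr (phi y) * pi))).
    by apply: (Aq) => //; rewrite addrC; exact: (Aq).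
  by rewrite fmorphV rmorphB rmorphN1; field.
exists phi; split.
  move=> x y; apply: phiE.
  rewrite rmorphD (_ : _ - _ = ratr 1 * (x - ratr (phi x) * pi) + (y - ratr (phi y) * pi)).
    exact: Aq.
  by rewrite rmorph1; ring.
move=> q x y xy.
have /rat_in_itvoo[r] : x - ratr q * pi < y - ratr q * pi by rewrite ltrD2r.
rewrite in_itv/= ltrBlDr ltrBrDr => rxy.
exists (ratr r + ratr q * pi) => //.
apply: phiE; rewrite addrK -[ratr r]mulr1 -[_ * 1]addr0.
by apply: (Aq) => //; have := Aq (-1) _ _ A1 A1; rewrite rmorphN1 mulN1r addNr.
Qed.

End rational_valued_additive.

(** * Uniqueness of laws *)

Section image_measure.
Context {R : realType}.

Lemma pushforward_measureE d d' (T1 : measurableType d) (T2 : measurableType d')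
    (mu : {measure set T1 -> \bar R}) (f : T1 -> T2) : measurable_fun setT f ->
  exists p : {measure set T2 -> \bar R}, (forall A, p A = mu (f @^-1` A)) /\
    forall g, measurable_fun setT g -> (forall x, 0 <= g x)%E ->
      (\int[p]_y g y = \int[mu]_x g (f x))%E.
Proof.
move=> mf; have @p : {measure set T2 -> \bar R}.
  by apply: (pushforward mu f); exact: mf.
exists p; split => // g mg g0.
exact: (ge0_integral_pushforward mf mu measurableT mg (fun x _ => g0 x)).
Qed.

Context d1 d2 d (T1 : measurableType d1) (T2 : measurableType d2)
  (S : measurableType d).
Variables (P : {measure set T1 -> \bar R}) (Q : {measure set T2 -> \bar R}).
Variables (f : T1 -> S) (g : T2 -> S).
Hypotheses (mf : measurable_fun setT f) (mg : measurable_fun setT g).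
Hypothesis PQ : forall A, measurable A -> P (f @^-1` A) = Q (g @^-1` A).
Local Open Scope ereal_scope.

Lemma ge0_integral_eq_law (h : S -> \bar R) : measurable_fun setT h ->
  (forall x, 0 <= h x) -> \int[P]_x h (f x) = \int[Q]_y h (g y).
Proof.
move=> mh h0; have [p [pE intp]] := pushforward_measureE P mf.
have [q [qE intq]] := pushforward_measureE Q mg.
rewrite -intp// -intq//; apply: eq_measure_integral => A mA _.
by rewrite pE qE PQ.
Qed.

Lemma integral_eq_law (h : S -> \bar R) : measurable_fun setT h ->
  \int[P]_x h (f x) = \int[Q]_y h (g y).
Proof.
move=> mh; rewrite integralE [RHS]integralE; congr (_ - _).
- have -> : (fun x => h (f x))^\+ = h^\+ \o f by rewrite -funepos_comp.
  have -> : (fun x => h (g x))^\+ = h^\+ \o g by rewrite -funepos_comp.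
  exact: (ge0_integral_eq_law (measurable_funepos mh) (funepos_ge0 h)).
- have -> : (fun x => h (f x))^\- = h^\- \o f by rewrite -funeneg_comp.
  have -> : (fun x => h (g x))^\- = h^\- \o g by rewrite -funeneg_comp.
  exact: (ge0_integral_eq_law (measurable_funeneg mh) (funeneg_ge0 h)).
Qed.

End image_measure.

Section measure_uniqueness.
Context {R : realType}.

Lemma measure_uniqueR (m1 m2 : {measure set R -> \bar R}) :
  (forall p, (m1 `]p, +oo[%classic < +oo)%E) ->
  (forall p, m1 `]p, +oo[%classic = m2 `]p, +oo[%classic) ->
  forall A, measurable A -> m1 A = m2 A.
Proof.
move=> fin1 m12 A mA.
apply: (measure_unique (@RGenOInfty.G R) (fun n => `](- n%:R), +oo[%classic)) => //.
- exact: RGenOInfty.measurableE.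
- move=> _ _ [x ->] [y ->]; exists (Num.max x y); apply/seteqP; split => z /=;
    by rewrite !in_itv/= !andbT gt_max => /andP.
- by move=> n; exists (- n%:R).
- apply/seteqP; split => // x _.
  exists (Num.truncn `|x|).+1 => //=; rewrite in_itv/= andbT ltrNl.
  by rewrite (le_lt_trans (ler_norm _))// normrN truncnS_gt.
- by move=> _ [p ->].
Qed.

Lemma probability_unique_prod d1 d2 (T1 : measurableType d1)
    (T2 : measurableType d2) (m1 m2 : probability (T1 * T2)%type R) :
  (forall A B, measurable A -> measurable B -> m1 (A `*` B) = m2 (A `*` B)) ->
  forall A, measurable A -> m1 A = m2 A.
Proof.
move=> m12 A mA.
apply: (measure_unique [set A `*` B | A in @measurable _ T1 & B in @measurable _ T2] (fun=> setT)) => //.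
- exact: measurable_prod_measurableType.
- move=> _ _ [A1 mA1 [B1 mB1 <-]] [A2 mA2 [B2 mB2 <-]]; rewrite -setXI.
  by exists (A1 `&` A2); [exact: measurableI|exists (B1 `&` B2) => //; exact: measurableI].
- by move=> _; exists setT => //; exists setT => //; rewrite setXTT.
- by rewrite bigcup_const.
- by move=> _ [A1 mA1 [B1 mB1 <-]]; exact: m12.
- by move=> _; rewrite (le_lt_trans (probability_le1 _ _))// ltry.
Qed.

(** Uniqueness on the line is applied to one factor at a time: the second factor stays a ray while
    the first becomes any Borel set, which is then frozen. The restrictions [mrestr] provide the
    finite measures on the line that this requires. *)
Lemma probability_uniqueRR (m1 m2 : probability (R * R)%type R) :
  (forall p q, m1 (`]p, +oo[%classic `*` `]q, +oo[%classic) = m2 (`]p, +oo[%classic `*` `]q, +oo[%classic)) ->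
  forall A, measurable A -> m1 A = m2 A.
Proof.
move=> m12; have finP (m : probability (R * R)%type R) A : measurable A -> (m A < +oo)%E.
  by move=> mA; rewrite (le_lt_trans (probability_le1 _ _))// ltry.
have m12l (A : set R) q : measurable A -> m1 (A `*` `]q, +oo[%classic) = m2 (A `*` `]q, +oo[%classic).
  move=> mA.
  pose mD : measurable (setT `*` `]q, +oo[%classic : set (R * R)) := measurableX measurableT (measurable_itv _).
  have := @measure_uniqueR (pushforward (mrestr m1 mD) fst) (pushforward (mrestr m2 mD) fst).
  have E (m : probability (R * R)%type R) B : pushforward (mrestr m mD) fst B = m (B `*` `]q, +oo[%classic).
    rewrite /pushforward /mrestr; congr (m _); apply/seteqP.
    by split => [[x y]/= [? [_ ?]]|[x y]/= [? ?]].
  move=> /(_ measurable_fst measurable_fst) H; rewrite -[LHS]E -[RHS]E; apply: H => // p; last first.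
    by rewrite [LHS]E [RHS]E.
  rewrite [ltLHS]E; apply: finP; exact: measurableX.
apply: probability_unique_prod => A B mA mB.
pose mD : measurable (A `*` setT : set (R * R)) := measurableX mA measurableT.
have := @measure_uniqueR (pushforward (mrestr m1 mD) snd) (pushforward (mrestr m2 mD) snd).
have E (m : probability (R * R)%type R) C : pushforward (mrestr m mD) snd C = m (A `*` C).
  rewrite /pushforward /mrestr; congr (m _); apply/seteqP.
  by split => [[x y]/= [? [? ?]]|[x y]/= [? ?]].
move=> /(_ measurable_snd measurable_snd) H; rewrite -[LHS]E -[RHS]E; apply: H => // p; last first.
  by rewrite [LHS]E [RHS]E; exact: m12l.
rewrite [ltLHS]E; apply: finP; exact: measurableX.
Qed.

End measure_uniqueness.

(** * Polynomial approximation of a step function *)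

Section step_polynomials.
Context {R : realType}.

Lemma bernoulli_le (s : R) n : -1 <= s -> 1 + n%:R * s <= (1 + s) ^+ n.
Proof.
move=> s1; elim: n => [|n IH]; first by rewrite mul0r addr0 expr0.
rewrite exprS; apply: (@le_trans _ _ ((1 + s) * (1 + n%:R * s))).
  rewrite -subr_ge0 (_ : _ - _ = n%:R * s ^+ 2); last by rewrite -natr1; ring.
  by rewrite mulr_ge0// sqr_ge0.
by rewrite ler_wpM2l// -lerBlDl sub0r.
Qed.

(** With y = sqrt x, the term is (n y^n) y^n, and Bernoulli's inequality for 1 / y = 1 + h bounds
    the first factor by 1 / h. *)
Lemma cvg_natr_expr (x : R) : 0 <= x < 1 -> n%:R * x ^+ n @[n --> \oo] --> 0.
Proof.
move=> /andP[x0 x1].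
have [->|xN0] := eqVneq x 0.
  apply: cvg_near_cst; exists 1%N => // -[//|n] _; by rewrite expr0n mulr0.
have {xN0}x0 : 0 < x by rewrite lt0r xN0.
pose y := Num.sqrt x; have y0 : 0 < y by rewrite sqrtr_gt0.
have y1 : y < 1 by rewrite -sqrtr1 ltr_sqrt.
have xE : x = y * y by rewrite -expr2 sqr_sqrtr// ltW.
pose h := y^-1 - 1.
have h0 : 0 < h by rewrite subr_gt0 invf_gt1.
have hy n : n%:R * y ^+ n <= h^-1.
  rewrite -[leRHS]mul1r ler_pdivlMr// mulrAC -ler_pdivlMr ?exprn_gt0// mul1r -exprVn.
  rewrite (_ : y^-1 = 1 + h); last by rewrite addrC subrK.
  apply: le_trans (bernoulli_le _ _); first by rewrite lerDr.
  by apply: le_trans (ltW h0).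
apply: (squeeze_cvgr (f := (fun=> 0)) (h := (fun n => h^-1 * y ^+ n))).
- apply: nearW => n; rewrite mulr_ge0 ?exprn_ge0 ?(ltW x0)//=.
  by rewrite xE exprMn mulrA ler_wpM2r// exprn_ge0// ltW.
- exact: cvg_cst.
- rewrite -[X in _ --> X](mulr0 h^-1); apply: cvgM; first exact: cvg_cst.
  by apply: cvg_expr; rewrite ger0_norm// ltW.
Qed.

(* The classical polynomial approximation of a step function, from the proof of
   the Stone-Weierstrass theorem. *)
Lemma cvg_step_polynomial (t : R) : 0 <= t <= 1 ->
  (1 - t ^+ n) ^+ (n * 2 ^ n) @[n --> \oo] --> ((t < 2^-1)%R%:R : R).
Proof.
move=> /andP[t0 t1]; have tn n : 0 <= t ^+ n <= 1 by rewrite exprn_ge0//= exprn_ile1.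
(* Below 1/2, Bernoulli's inequality gives the lower bound 1 - n (2 t)^n. From 1/2 on, s = 2^-n is
   at most t^n and (1 - s)^N <= (1 + s)^-N <= 1 / (1 + N s), where N = n 2^n makes N s equal to
   n. *)
have [t2|t2] := ltP t 2^-1.
  apply: (squeeze_cvgr (f := (fun n => 1 - n%:R * (2 * t) ^+ n)) (h := (fun=> 1))).
  - apply: nearW => n; have /andP[h1 h2] := tn n; apply/andP; split; last first.
      by rewrite exprn_ile1 ?subr_ge0// lerBlDr lerDl.
    rewrite (le_trans _ (bernoulli_le _ _)) ?lerN2//.
    by rewrite mulrN lerD2l lerN2 natrM natrX exprMn mulrA.
  - rewrite -[X in _ --> X]subr0; apply: cvgB; first exact: cvg_cst.
    by apply: cvg_natr_expr; rewrite mulr_ge0//= mulrC -ltr_pdivlMr// mul1r.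
  - exact: cvg_cst.
apply: (squeeze_cvgr (f := (fun=> 0)) (h := (fun n => n.+1%:R^-1))).
- apply: nearW => n; have /andP[h1 h2] := tn n.
  rewrite exprn_ge0 ?subr_ge0//=.
  have s0 : 0 <= (2^-1 : R) ^+ n by rewrite exprn_ge0.
  apply: (@le_trans _ _ (((1 + 2^-1 ^+ n) ^+ (n * 2 ^ n))^-1)).
    rewrite -exprVn lerXn2r ?nnegrE ?subr_ge0// ?invr_ge0 ?addr_ge0//.
    apply: (@le_trans _ _ (1 - 2^-1 ^+ n)); first by rewrite lerD2l lerN2 lerXn2r// nnegrE.
    rewrite -[leRHS]mul1r ler_pdivlMr ?ltr_pwDl//.
    rewrite -subr_ge0 (_ : _ - _ = (2^-1 ^+ n) ^+ 2); last by ring.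
    exact: sqr_ge0.
  rewrite lef_pV2 ?posrE ?exprn_gt0 ?ltr_pwDl//.
  rewrite (le_trans _ (bernoulli_le _ _))//; last by rewrite (le_trans _ s0).
  by rewrite natrM natrX exprVn mulfK ?expf_neq0// addrC natr1.
- exact: cvg_cst.
- exact: cvg_harmonic.
Qed.

End step_polynomials.

Section bounded_functions.
Context {R : realType} d (T : measurableType d).
Implicit Types (mu : probability T R) (f : T -> R).

Lemma bounded_probability_integrable mu f M : measurable_fun setT f ->
  (forall x, `|f x| <= M) -> mu.-integrable setT (EFin \o f).
Proof.
move=> mf fM; apply: measurable_bounded_integrable => //.
  by rewrite (le_lt_trans (probability_le1 _ _))// ltry.
by exists M; split; [exact: num_real|move=> y My x _; exact: le_trans (fM x) (ltW My)].
Qed.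

Lemma bounded_probability_cvg mu (f_ : nat -> T -> R) f M :
  (forall n, measurable_fun setT (f_ n)) -> (forall n x, `|f_ n x| <= M) ->
  (forall x, f_ ^~ x @ \oo --> f x) ->
  (\int[mu]_x (f_ n x)%:E @[n --> \oo] --> \int[mu]_x (f x)%:E)%E.
Proof.
move=> mf fM ff.
have mlim : measurable_fun setT f by apply: measurable_fun_cvg mf _ => x _; exact: ff.
have [] := @dominated_convergence _ _ _ mu setT measurableT
  (fun n x => (f_ n x)%:E) (fun x => (f x)%:E) (cst M%:E).
- by move=> n; exact/measurable_EFinP.
- exact/measurable_EFinP.
- by apply: aeW => x _; apply: cvg_EFin; [exact: nearW|exact: ff].
- exact: (@bounded_probability_integrable mu (cst M) `|M|).
- by apply: aeW => x n _; rewrite lee_fin.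
by [].
Qed.

End bounded_functions.

(** * Trigonometric integrals determine a law on the plane *)

Section trigonometric_uniqueness.
Context {R : realType}.
Variables m1 m2 : probability (R * R)%type R.

Local Notation wave a b c := (fun x : R * R => cos (a * x.1 + b * x.2 + c)).

Hypothesis m12 : forall a b c,
  (\int[m1]_x (wave a b c x)%:E = \int[m2]_x (wave a b c x)%:E)%E.

Lemma measurable_wave (a b c : R) : measurable_fun setT (wave a b c).
Proof.
apply: measurableT_comp => //.
  by apply: continuous_measurable_fun => x; exact: continuous_cos.
apply: measurable_funD => //; apply: measurable_funD; apply: measurable_funM => //.
Qed.

(* The bounded functions that the two measures cannot tell apart, even after
   multiplication by a plane wave. This class is stable under polynomials in a
   wave and bounded limits, hence contains the indicators of half-planes and of
   their intersections. *)
Let same (f : R * R -> R) := [/\ measurable_fun setT f, (exists M : R, forall x, `|f x| <= M) &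
  forall a b c, (\int[m1]_x (f x * wave a b c x)%:E =
                 \int[m2]_x (f x * wave a b c x)%:E)%E].

Let same_cvg (f_ : nat -> R * R -> R) (f : R * R -> R) (M : R) : (forall n, same (f_ n)) ->
  (forall n x, `|f_ n x| <= M) -> (forall x, f_ ^~ x @ \oo --> f x) -> same f.
Proof.
move=> fs fM ff; split.
- by apply: measurable_fun_cvg (fun n => (let: And3 h _ _ := fs n in h)) _ => x _; exact: ff.
- exists M => x; have nf : `|f_ n x| @[n --> \oo] --> `|f x|.
    by apply: cvg_norm; exact: ff.
  by rewrite -(cvg_lim _ nf)//; apply: limr_le; [exact: cvgP nf|exact: nearW].
- move=> a b c.
  have H (m : probability (R * R)%type R) :
      (\int[m]_x (f_ n x * wave a b c x)%:E @[n --> \oo] -->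
       \int[m]_x (f x * wave a b c x)%:E)%E.
    apply: (@bounded_probability_cvg _ _ _ _ _ _ M) => //.
    + by move=> n; apply: measurable_funM; [case: (fs n)|exact: measurable_wave].
    + by move=> n x; rewrite normrM -[M]mulr1 ler_pM// cos_max.
    + by move=> x; apply: cvgM; [exact: ff|exact: cvg_cst].
  have E : (fun n => \int[m1]_x (f_ n x * wave a b c x)%:E)%E =
           (fun n => \int[m2]_x (f_ n x * wave a b c x)%:E)%E.
    by apply/funext => n; case: (fs n).
  have := H m1; rewrite E => H1.
  by have := cvg_unique _ H1 (H m2); apply; exact: ereal_hausdorff.
Qed.

Let int_same (m : probability (R * R)%type R) f a b c : same f ->
  m.-integrable setT (EFin \o (fun x => f x * wave a b c x)).
Proof.
move=> [mf [M fM] _]; apply: (@bounded_probability_integrable _ _ _ _ _ M).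
  by apply: measurable_funM => //; exact: measurable_wave.
by move=> x; rewrite normrM -[M]mulr1 ler_pM// cos_max.
Qed.

Let sameD f g : same f -> same g -> same (f \+ g).
Proof.
move=> sf sg; split.
- by apply: measurable_funD; [case: sf|case: sg].
- case: sf sg => _ [M fM] _ [_ [N gN] _]; exists (M + N) => x.
  by rewrite (le_trans (ler_normD _ _))// lerD.
- move=> a b c; have H (m : probability (R * R)%type R) :
      (\int[m]_x ((f \+ g) x * wave a b c x)%:E =
       \int[m]_x (f x * wave a b c x)%:E + \int[m]_x (g x * wave a b c x)%:E)%E.
    rewrite -integralD_EFin//; [|exact: int_same|exact: int_same].
    by apply: eq_integral => x _; rewrite /= mulrDl.
  by rewrite !H; case: sf => _ _ ->; case: sg => _ _ ->.
Qed.

Let sameZ k f : same f -> same (fun x => k * f x).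
Proof.
move=> sf; split.
- by apply: measurable_funM => //; case: sf.
- by case: sf => _ [M fM] _; exists (`|k| * M) => x; rewrite normrM ler_wpM2l.
- move=> a b c; have H (m : probability (R * R)%type R) :
      (\int[m]_x (k * f x * wave a b c x)%:E =
       k%:E * \int[m]_x (f x * wave a b c x)%:E)%E.
    rewrite -integralZl//; last exact: int_same.
    by apply: eq_integral => x _; rewrite -EFinM mulrA.
  by rewrite !H; case: sf => _ _ ->.
Qed.

(** A product of two waves is half the sum of the waves with added and with subtracted frequencies
    and phases; hence the extra wave in [same]. *)
Let same_wave f a b c : same f -> same (fun x => f x * wave a b c x).
Proof.
move=> sf; split.
- by apply: measurable_funM; [case: sf|exact: measurable_wave].
- by case: sf => _ [M fM] _; exists M => x; rewrite normrM -[M]mulr1 ler_pM// cos_max.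
- move=> a' b' c'; have H (m : probability (R * R)%type R) :
      (\int[m]_x (f x * wave a b c x * wave a' b' c' x)%:E =
       2^-1%:E * (\int[m]_x (f x * wave (a + a') (b + b') (c + c') x)%:E
       + \int[m]_x (f x * wave (a - a') (b - b') (c - c') x)%:E))%E.
    rewrite -integralD_EFin//; [|exact: int_same|exact: int_same].
    rewrite -integralZl//; last by apply: integrableD; rewrite //; exact: int_same.
    apply: eq_integral => x _; rewrite /= -EFinD -EFinM; congr EFin.
    rewrite (_ : (a + a') * _ + _ + _ = (a * x.1 + b * x.2 + c) + (a' * x.1 + b' * x.2 + c')); last by ring.
    rewrite (_ : (a - a') * _ + _ + _ = (a * x.1 + b * x.2 + c) - (a' * x.1 + b' * x.2 + c')); last by ring.
    move: (a * _ + _ + c) (a' * _ + _ + _) => u v.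
    by rewrite cosD cosB; field.
  by rewrite !H; case: sf => _ _ E; rewrite !E.
Qed.

Let same_poly f a b c (p : {poly R}) : same f ->
  same (fun x => f x * p.[wave a b c x]).
Proof.
move=> sf; elim/poly_ind: p => [|p k IH].
  rewrite (_ : (fun _ => _) = (fun x => 0 * f x)); first exact: sameZ.
  by apply/funext => x; rewrite horner0 mulr0 mul0r.
rewrite (_ : (fun _ => _) = (fun x => f x * p.[wave a b c x] * wave a b c x) \+ (fun x => k * f x)).
  by apply: sameD; [exact: same_wave|exact: sameZ].
by apply/funext => x; rewrite /= hornerMXaddC mulrDr mulrA (mulrC k).
Qed.

(** For t = (1 - wave) / 2, which lies in [0, 1], the wave is positive exactly when t < 1/2, so the
    step polynomials in t converge to the indicator. *)
Let same_step f a b c : same f ->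
  same (fun x => f x * (0 < wave a b c x)%R%:R).
Proof.
move=> sf; have [_ [M fM] _] := sf.
pose p n : {poly R} := (1 - ((1 - 'X) * (2^-1)%:P) ^+ n) ^+ (n * 2 ^ n).
have pE n (y : R) : (p n).[y] = (1 - ((1 - y) / 2) ^+ n) ^+ (n * 2 ^ n).
  by rewrite !(hornerE, horner_exp).
have t01 (x : R * R) : 0 <= (1 - wave a b c x) / 2 <= 1.
  have := cos_max (a * x.1 + b * x.2 + c); rewrite ler_norml => /andP[h1 h2].
  by apply/andP; split; lra.
apply: (@same_cvg (fun n x => f x * (p n).[wave a b c x]) _ M).
- by move=> n; exact: same_poly.
- move=> n x; rewrite normrM -[M]mulr1 ler_pM// pE.
  have /andP[t0 t1] := t01 x.
  have s0 := exprn_ge0 n t0; have s1 := exprn_ile1 n t0 t1.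
  have r0 : 0 <= 1 - ((1 - wave a b c x) / 2) ^+ n by rewrite subr_ge0.
  by rewrite ger0_norm ?exprn_ge0// exprn_ile1// lerBlDr lerDl.
- move=> x; apply: cvgM; first exact: cvg_cst.
  have := cvg_step_polynomial (t01 x).
  rewrite (_ : (_ < 2^-1)%R = (0 < wave a b c x)); last by apply/idP/idP; lra.
  by under eq_fun do rewrite -pE.
Qed.

(** Dividing the frequencies by n + 1 and shifting the phase by a quarter period gives the wave sin
    (v / (n + 1)) with v = a x1 + b x2 - c. It has the sign of v once n + 1 exceeds |v|, its
    argument then lying in ]-pi, pi[. *)
Let same_halfspace f a b c : same f ->
  same (fun x => f x * (c < a * x.1 + b * x.2)%R%:R).
Proof.
move=> sf; have [_ [M fM] _] := sf.
apply: (@same_cvg (fun n x => f x *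
  (0 < wave (a / n.+1%:R) (b / n.+1%:R) (- c / n.+1%:R - pi / 2) x)%R%:R) _ M).
- by move=> n; exact: same_step.
- move=> n x; rewrite normrM -[M]mulr1 ler_pM//.
  by case: (_ < _); rewrite /= ?normr1 ?normr0.
- move=> x; apply: cvgM; first exact: cvg_cst.
  set v := a * x.1 + b * x.2 - c.
  rewrite -[c < _]subr_gt0 -/v.
  apply: cvg_near_cst; exists (Num.truncn `|v|) => // n /= vn.
  rewrite (_ : _ + (_ - _) = v / n.+1%:R - pi / 2); last by rewrite /v; field.
  rewrite cosBpihalf; congr (_%:R : R); congr nat_of_bool.
  have vpi : `|v| / n.+1%:R < pi.
    rewrite (@lt_trans _ _ 1)//; last by rewrite (lt_le_trans _ (pi_ge2 _))// ltr1n.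
    rewrite ltr_pdivrMr// mul1r (lt_le_trans (truncnS_gt _))// ler_nat.
    by rewrite ltnS.
  apply/idP/idP => [|v0].
    apply: contraTT; rewrite -!leNgt => v0.
    rewrite -[v]opprK mulNr sinN oppr_le0 sin_ge0_pi// -(ler0_norm v0).
    by rewrite divr_ge0//= ltW.
  by rewrite sin_gt0_pi// divr_gt0//= -(gtr0_norm v0).
Qed.

(** The uniqueness theorem for characteristic functions, in real form: the phase [c] supplies
    cosines and sines at once. The indicator of a quadrant is a product of two half-plane
    indicators, and quadrants determine the law. *)
Lemma trigonometric_unique A : measurable A -> m1 A = m2 A.
Proof.
apply: probability_uniqueRR => p q.
have s1 : same (fun=> 1).
  split => //; first by exists 1 => x; rewrite normr1.
  by move=> a b c; under eq_integral do rewrite mul1r; rewrite m12; apply: eq_integral => x _; rewrite mul1r.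
have [_ _ /(_ 0 0 0) E] := same_halfspace 0 1 q (same_halfspace 1 0 p s1).
have H (m : probability (R * R)%type R) : m (`]p, +oo[%classic `*` `]q, +oo[%classic) =
   (\int[m]_x (1 * (p < 1 * x.1 + 0 * x.2)%R%:R * (q < 0 * x.1 + 1 * x.2)%R%:R * cos (0 * x.1 + 0 * x.2 + 0))%:E)%E.
  have mD : measurable (`]p, +oo[%classic `*` `]q, +oo[%classic : set (R * R)) by exact: measurableX.
  rewrite -[X in m X]setIT -integral_indic//; apply: eq_integral => x _.
  rewrite !(mul0r, mul1r, addr0, add0r) cos0 mulr1 indicE; congr EFin.
  rewrite -natrM mulnb; congr (_%:R : R); congr nat_of_bool.
  apply/idP/idP; rewrite inE/= !in_itv/= !andbT; first by move=> [-> ->].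
  by move/andP.
by rewrite !H.
Qed.

End trigonometric_uniqueness.

(** A plane wave is a function of one linear form, so its integral depends only on the law of that
    form. *)
Lemma cramer_wold {R : realType} (m1 m2 : probability (R * R)%type R) :
  (forall (a b : R) (A : set R), measurable A ->
    m1 ((fun x => a * x.1 + b * x.2) @^-1` A) =
    m2 ((fun x => a * x.1 + b * x.2) @^-1` A)) ->
  forall A, measurable A -> m1 A = m2 A.
Proof.
move=> m12; apply: trigonometric_unique => a b c.
pose g (x : R * R) := a * x.1 + b * x.2.
have mg : measurable_fun setT g by apply: measurable_funD; apply: measurable_funM.
have mc : measurable_fun setT (fun y : R => cos (y + c)).
  apply: measurableT_comp; last exact: measurable_funD.
  by apply: continuous_measurable_fun => x; exact: continuous_cos.
apply: (integral_eq_law mg mg _ (h := fun y => (cos (y + c))%:E)).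
  exact: m12.
exact/measurable_EFinP.
Qed.

Lemma cramer_wold_image {R : realType} (P : probability (R * R)%type R)
    (f : R * R -> R * R) : measurable_fun setT f ->
  (forall (a b : R) (A : set R), measurable A ->
    P [set u | A (a * (f u).1 + b * (f u).2)] = P [set u | A (a * u.1 + b * u.2)]) ->
  forall A, measurable A -> P (f @^-1` A) = P A.
Proof.
move=> mf PE A mA.
pose F : {mfun (R * R)%type >-> (R * R)%type} :=
  HB.pack f (isMeasurableFun.Build _ _ _ _ f mf).
by apply: (@cramer_wold R (distribution P F) P) => // a b B mB; exact: PE.
Qed.

(** * Gaussian laws *)

Section density.
Local Open Scope ereal_scope.
Context d (T : measurableType d) (R : realType).
Variables (mu nu : {measure set T -> \bar R}) (g : T -> R).
Hypotheses (g0 : forall x, (0 <= g x)%R) (mg : measurable_fun setT g).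
Hypothesis nuE : forall A, measurable A -> nu A = \int[mu]_(x in A) (g x)%:E.

Import HBNNSimple.

Let integral_density_nnsfun (h : {nnsfun T >-> R}) :
  \int[nu]_x (h x)%:E = \int[mu]_x ((h x)%:E * (g x)%:E).
Proof.
under [LHS]eq_integral do rewrite fimfunE -fsumEFin//.
rewrite [LHS]ge0_integral_fsum//; last 2 first.
  - by move=> r; exact/measurable_EFinP/measurableT_comp.
  - by move=> n x _; rewrite EFinM nnfun_muleindic_ge0.
under [RHS]eq_integral.
  move=> x xD; rewrite fimfunE -fsumEFin// ge0_mule_fsuml; last first.
    by move=> r; rewrite EFinM nnfun_muleindic_ge0.
  over.
rewrite [RHS]ge0_integral_fsum//; last 2 first.
  - move=> r; apply: emeasurable_funM; last exact/measurable_EFinP.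
    exact/measurable_EFinP/measurableT_comp.
  - move=> n x _; apply: mule_ge0; last by rewrite lee_fin.
    by rewrite EFinM nnfun_muleindic_ge0.
apply: eq_fsbigr => r _; rewrite integralZl_indic_nnsfun//= integral_indic// setIT nuE//.
have mh : measurable (h @^-1` [set r]) by [].
have [r0|r0] := leP 0%R r; last first.
  rewrite preimage_nnfun0//; rewrite integral_set0 mule0.
  by apply/esym/integral0_eq => x _; rewrite indic0 mulr0 mul0e.
rewrite integral_mkcond -ge0_integralZl//=.
- apply: eq_integral => x _. rewrite patchE indicE EFinM -muleA.
  by case: ifPn => _; rewrite ?mul1e// mul0e.
- by apply/(measurable_restrictT _ _).1 => //; exact/measurable_EFinP/measurable_funTS.
- by move=> x _; rewrite patchE; case: ifPn => //; rewrite lee_fin.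
Qed.

Lemma ge0_integral_density f : measurable_fun setT f -> (forall x, 0 <= f x) ->
  \int[nu]_x f x = \int[mu]_x (f x * (g x)%:E).
Proof.
move=> mf f0; pose f_ := nnsfun_approx measurableT mf.
transitivity (lim (\int[nu]_x (f_ n x)%:E @[n --> \oo])).
  rewrite -monotone_convergence//=.
  - apply: eq_integral => ? /[!inE] xD; apply/esym/cvg_lim => //=.
    exact: cvg_nnsfun_approx.
  - by move=> n; exact/measurable_EFinP/measurable_funTS.
  - by move=> n ? _; rewrite lee_fin.
  - by move=> ? _ ? ? mn; rewrite lee_fin; exact/lefP/nd_nnsfun_approx.
under eq_fun do rewrite integral_density_nnsfun.
rewrite -monotone_convergence//=.
- apply: eq_integral => x _; apply/cvg_lim => //; apply: cvgeZr => //.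
  exact: cvg_nnsfun_approx.
- by move=> n; apply/measurable_EFinP/measurable_funM.
- by move=> n x _; rewrite lee_fin mulr_ge0.
- move=> x _ m n mn; rewrite lee_fin ler_wpM2r//; exact/lefP/nd_nnsfun_approx.
Qed.

End density.

Section normal_law.
Context {R : realType}.
Implicit Types m s : R.

Local Notation leb := (@lebesgue_measure R).

Lemma measurable_affine m s : measurable_fun setT (fun z : R => m + s * z).
Proof. by apply: measurable_funD => //; exact: measurable_funM. Qed.

(** The right-hand side is a measure in [A] that agrees with the Lebesgue measure on the intervals
    ]a, b], which characterise it. For negative [s] the preimages are closed on the left instead of
    the right, which leaves their lengths unchanged. *)
Lemma lebesgue_measure_affine m s (A : set R) : s != 0 -> measurable A ->
  leb A = (`|s|%:E * leb ((fun z => (m + s * z)%R) @^-1` A))%E.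
Proof.
move=> s0 mA.
have [p [pE intp]] := @pushforward_measureE R _ _ _ (measurableTypeR R) leb _ (measurable_affine m s).
have {}pE (B : set R) : p B = lebesgue_measure ((fun z => m + s * z) @^-1` B) by exact: pE.
have -> : (`|s|%:E * leb ((fun z => (m + s * z)%R) @^-1` A))%E =
    mscale (NngNum (normr_ge0 s)) p A by rewrite /mscale pE.
apply: (@lebesgue_measure_unique R (mscale (NngNum (normr_ge0 s)) p)) => // _ [[a b]] _ <-.
rewrite /= /mscale/= pE /=.
have [s_gt0|s_le0] := ltP 0 s.
  rewrite (_ : _ @^-1` _ = `](a - m) / s, (b - m) / s]%classic).
    rewrite [LHS]lebesgue_measure_itv lebesgue_measure_itv/= !lte_fin ltr_pM2r ?invr_gt0// ltrD2r.
    case: ifP => ab; last by rewrite mule0.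
    by rewrite -EFinB -EFinM gtr0_norm//; congr EFin; field.
  apply/seteqP; split => z /=; rewrite !in_itv/= ltr_pdivrMr// ler_pdivlMr//;
    by rewrite ltrBlDl lerBrDl (mulrC z).
have s_lt0 : s < 0 by rewrite lt_neqAle s0.
rewrite (_ : _ @^-1` _ = `[(b - m) / s, (a - m) / s[%classic).
  rewrite [LHS]lebesgue_measure_itv lebesgue_measure_itv/= !lte_fin ltr_nM2r ?invr_lt0// ltrD2r.
  case: ifP => ab; last by rewrite mule0.
  by rewrite -EFinB -EFinM ltr0_norm//; congr EFin; field.
apply/seteqP; split => z /=; rewrite !in_itv/= ltr_ndivlMr// ler_ndivrMr//;
  by rewrite ltrBlDl lerBrDl (mulrC z) andbC.
Qed.

Lemma ge0_integral_normal m s (f : R -> \bar R) : measurable_fun setT f ->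
  (forall x, 0 <= f x)%E ->
  (\int[normal_prob m s]_x f x = \int[leb]_x (f x * (normal_pdf m s x)%:E))%E.
Proof.
move=> mf f0; apply: ge0_integral_density => //.
- exact: normal_pdf_ge0.
- exact: measurable_normal_pdf.
Qed.

(* Unlike [normal_prob m s], also meaningful for [s = 0]. *)
Definition gauss m s (A : set R) : \bar R :=
  normal_prob 0 1 ((fun z => m + s * z) @^-1` A).

Lemma normal_prob_gauss m s A : s != 0 -> measurable A ->
  normal_prob m s A = gauss m s A.
Proof.
move=> s0 mA; rewrite /gauss.
have mB : measurable ((fun z => m + s * z) @^-1` A).
  by rewrite -[X in measurable X]setTI; exact: measurable_affine.
pose h (x : R) : \bar R := ((\1_A x)%:E * (normal_pdf m s x)%:E)%E.
have h0 x : (0 <= h x)%E by rewrite mule_ge0// lee_fin ?normal_pdf_ge0.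
have mh : measurable_fun setT h.
  by apply: emeasurable_funM; apply/measurable_EFinP => //; exact: measurable_normal_pdf.
have mphi := measurable_affine m s.
have [p [pE intp]] := @pushforward_measureE R _ _ _ (measurableTypeR R) leb _ mphi.
transitivity (\int[leb]_x h x)%E.
  rewrite /normal_prob integral_mkcond; apply: eq_integral => x _.
  by rewrite patchE /h indicE; case: ifP => _; rewrite ?mul1e ?mul0e.
transitivity (\int[mscale (NngNum (normr_ge0 s)) p]_x h x)%E.
  apply: eq_measure_integral => B mB' _; rewrite /= /mscale/= pE.
  exact: lebesgue_measure_affine.
rewrite ge0_integral_mscale//.
rewrite intp//.
rewrite -ge0_integralZl//=; last exact: measurableT_comp.
rewrite /normal_prob [RHS]integral_mkcond; apply: eq_integral => z _.
rewrite patchE /h indicE /= -[(_ \in _ @^-1` _)]/(m + s * z \in A).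
have [zA|zA] := boolP (m + s * z \in A); last first.
  by rewrite mul0e mule0; case: ifP => // /set_mem/= /mem_set; rewrite (negbTE zA).
case: ifP => [_|]; last by rewrite mem_set//; exact: set_mem.
rewrite mul1e -EFinM; congr EFin.
rewrite !normal_pdfE//= /normal_fun /normal_peak mulrA; congr (_ * expR _).
  rewrite expr1n mul1r -mulrnAr sqrtrM ?sqr_ge0// sqrtr_sqr invfM mulrA.
  by rewrite divff ?mul1r// normr_eq0.
by field.
Qed.

Lemma gauss_sqr m s s' A : s ^+ 2 = s' ^+ 2 -> measurable A ->
  gauss m s A = gauss m s' A.
Proof.
move=> ss mA; have [s0|s0] := eqVneq s 0.
  have /eqP : s' ^+ 2 = 0 by rewrite -ss s0 expr0n.
  by rewrite sqrf_eq0 s0 => /eqP ->.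
have s'0 : s' != 0 by rewrite -sqrf_eq0 -ss sqrf_eq0.
rewrite -!normal_prob_gauss// /normal_prob; apply: eq_integral => x _.
by rewrite !normal_pdfE//= /normal_fun /normal_peak ss.
Qed.

Lemma gauss0 m A : gauss m 0 A = \d_m A.
Proof.
rewrite /gauss diracE; case: (boolP (m \in A)) => mA.
  rewrite (_ : _ @^-1` _ = setT) ?probability_setT//.
  by apply/seteqP; split => // z _ /=; rewrite mul0r addr0; exact: set_mem.
rewrite (_ : _ @^-1` _ = set0) ?measure0//.
by apply/seteqP; split => // z /=; rewrite mul0r addr0 => /mem_set; rewrite (negbTE mA).
Qed.

Lemma gaussian_lawP (mu : set R -> \bar R) :
  gaussian_law mu <-> exists m s, forall A, measurable A -> mu A = gauss m s A.
Proof.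
split=> -[m [s H]]; exists m, s => A mA; rewrite H//; have [->|s0] := eqVneq s 0.
- by rewrite gauss0.
- by rewrite normal_prob_gauss.
- by rewrite gauss0.
- by rewrite normal_prob_gauss.
Qed.

End normal_law.

(** * Gaussian mixtures of Gaussian laws *)

Section gauss_convolution.
Context {R : realType}.
Implicit Types m s a b : R.

Local Notation leb := (@lebesgue_measure R).

(** The value at x is the measure of the section at x of a measurable subset of the plane. *)
Lemma measurable_gauss m a b (A : set R) : measurable A ->
  measurable_fun setT (fun x => gauss (m + a * x) b A).
Proof.
move=> mA; pose B := [set u : R * R | A (m + a * u.1 + b * u.2)].
have mB : measurable B.
  rewrite -[X in measurable X]setTI.
  apply: (_ : measurable_fun setT (fun u : R * R => m + a * u.1 + b * u.2)) => //.
  by apply: measurable_funD; [apply: measurable_funD => //|]; apply: measurable_funM.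
have := measurable_fun_xsection (normal_prob 0 1) mB.
congr (measurable_fun _ _); apply/funext => x; congr normal_prob.
by apply/seteqP; split => z /=; rewrite /xsection/= inE.
Qed.

(** Completing the square: for independent standard normal x and z, the joint density of x and w = m
    + a x + b z is the density of w times the conditional density of x given w. *)
Lemma normal_pdf_mul m a b x w : a != 0 -> b != 0 ->
  let S2 := a ^+ 2 + b ^+ 2 in
  normal_pdf (m + a * x) b w * normal_pdf 0 1 x =
  normal_pdf m (Num.sqrt S2) w *
    normal_pdf (a * (w - m) / S2) (b / Num.sqrt S2) x.
Proof.
move=> a0 b0 S2.
have S20 : 0 < S2 by rewrite ltr_wpDl ?sqr_ge0// exprn_even_gt0.
have S0 : Num.sqrt S2 != 0 by rewrite sqrtr_eq0 -ltNge.
have bS0 : b / Num.sqrt S2 != 0 by rewrite mulf_neq0// invr_eq0.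
have a2b2 : a ^+ 2 + b ^+ 2 != 0 by rewrite gt_eqF.
have pk (t : R) : 0 <= t ^+ 2 * pi *+ 2.
  by rewrite mulrn_wge0// mulr_ge0 ?sqr_ge0 ?pi_ge0.
rewrite !normal_pdfE//= mulrACA [RHS]mulrACA; congr (_ * _).
  rewrite /normal_peak -!invfM -!sqrtrM ?pk//.
  congr (Num.sqrt _)^-1; rewrite expr_div_n sqr_sqrtr ?ltW//.
  by rewrite /S2; field.
rewrite /normal_fun -!expRD; congr expR.
rewrite expr_div_n sqr_sqrtr ?ltW// /S2.
by field; rewrite a2b2 b0.
Qed.

(** Tonelli's theorem leaves the density of the mixture times the integral of a conditional density,
    which is 1. For b = 0 there is no density, and for a = 0 nothing to mix: both are treated
    apart. *)
Lemma gauss_convolution m a b A : measurable A ->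
  (\int[normal_prob 0 1]_x gauss (m + a * x) b A =
   gauss m (Num.sqrt (a ^+ 2 + b ^+ 2)) A)%E.
Proof.
move=> mA; have [->|a0] := eqVneq a 0.
  under eq_integral do rewrite mul0r addr0.
  rewrite integral_cst//= [X in (_ * X)%E](_ : _ = 1%E) ?mule1; last exact: probability_setT.
  by apply: gauss_sqr => //; rewrite expr0n add0r sqr_sqrtr// sqr_ge0.
have [->|b0] := eqVneq b 0.
  rewrite [RHS](@gauss_sqr _ _ _ a)//; last first.
    by rewrite expr0n addr0 sqr_sqrtr// sqr_ge0.
  have mB : measurable ((fun x => m + a * x) @^-1` A).
    by rewrite -[X in measurable X]setTI; exact: measurable_affine.
  rewrite /gauss -[X in normal_prob _ _ X]setIT -integral_indic//.
  by apply: eq_integral => x _; rewrite -/(gauss _ _ _) gauss0.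
pose S2 := a ^+ 2 + b ^+ 2.
have S20 : 0 < S2 by rewrite ltr_wpDl ?sqr_ge0// exprn_even_gt0.
have S0 : Num.sqrt S2 != 0 by rewrite sqrtr_eq0 -ltNge.
rewrite -normal_prob_gauss// ge0_integral_normal//; last exact: measurable_gauss.
pose f (u : R * R) : \bar R :=
  (\1_A u.2 * normal_pdf (m + a * u.1) b u.2 * normal_pdf 0 1 u.1)%:E.
have f0 u : (0 <= f u)%E by rewrite lee_fin !mulr_ge0 ?normal_pdf_ge0.
have mf : measurable_fun setT f.
  apply/measurable_EFinP; apply: measurable_funM; last first.
    exact: measurableT_comp (measurable_normal_pdf 0 1) measurable_fst.
  apply: measurable_funM; first exact: measurableT_comp measurable_snd.
  rewrite (_ : (fun _ => _) = normal_pdf 0 b \o (fun u : R * R => u.2 - (m + a * u.1))).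
    apply: measurableT_comp; first exact: measurable_normal_pdf.
    by apply: measurable_funB => //; apply: measurable_funD => //; apply: measurable_funM.
  by apply/funext => u /=; rewrite !normal_pdfE//= /normal_fun subr0.
transitivity (\int[leb]_x \int[leb]_w f (x, w))%E.
  apply: eq_integral => x _; rewrite -normal_prob_gauss// /normal_prob.
  rewrite muleC -ge0_integralZl//; last 3 first.
  - by apply/measurable_funTS/measurable_EFinP; exact: measurable_normal_pdf.
  - by move=> w _; rewrite lee_fin normal_pdf_ge0.
  - by rewrite lee_fin normal_pdf_ge0.
  rewrite integral_mkcond; apply: eq_integral => w _.
  rewrite patchE /f/= indicE; case: ifP => _; last by rewrite !mul0r.
  by rewrite mul1r -EFinM mulrC.
transitivity (\int[leb]_w \int[leb]_x f (x, w))%E.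
  exact: (@fubini_tonelli _ _ _ _ _ leb leb f mf f0).
rewrite /normal_prob [RHS]integral_mkcond; apply: eq_integral => w _.
rewrite patchE /f/= indicE; case: ifP => _; last first.
  by under eq_integral do rewrite !mul0r; rewrite integral0.
under eq_integral do rewrite mul1r normal_pdf_mul// EFinM.
rewrite ge0_integralZl//.
- by rewrite integral_normal_pdf mule1.
- by apply/measurable_EFinP; exact: measurable_normal_pdf.
- by move=> x _; rewrite lee_fin normal_pdf_ge0.
- by rewrite lee_fin normal_pdf_ge0.
Qed.

End gauss_convolution.

(** * Moments of Gaussian laws *)

Section normal_moments.
Context {R : realType}.

Local Notation leb := (@lebesgue_measure R).
Local Notation phi := (normal_pdf (0 : R) 1).

Let phiE (x : R) : phi x = normal_peak 1 * expR (- (x ^+ 2 / 2)).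
Proof. by rewrite normal_pdfE//= /normal_fun subr0 expr1n mulNr. Qed.

Let is_derive_phi (x : R) : is_derive x 1 (fun x => - phi x) (x * phi x).
Proof.
rewrite (_ : (fun x => - phi x) =
    (fun x => (- normal_peak 1) * (expR \o (fun x : R => - (x ^+ 2 / 2))) x)); last first.
  by apply/funext => y; rewrite phiE mulNr.
have h : is_derive x 1 (fun x : R => - (x ^+ 2 / 2)) (- x).
  apply: is_derive_eq.
    by rewrite /GRing.scale/=; field.
have k := @is_derive1_comp _ _ _ _ _ _ (is_derive_expR _) h.
apply: (is_derive_eq (is_deriveZ (- normal_peak 1) k)).
by rewrite phiE /GRing.scale/=; ring.
Qed.

Let continuous_phi : continuous phi.
Proof. exact: continuous_normal_pdf. Qed.

Let cvg_phi : - phi x @[x --> +oo] --> 0.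
Proof.
rewrite (_ : (fun x => _) = (fun x => - (normal_peak 1 * expR (- (x ^+ 2 / 2))))); last first.
  by apply/funext => x; rewrite phiE.
rewrite -oppr0; apply: cvgN; rewrite -(mulr0 (normal_peak 1)); apply: cvgM; first exact: cvg_cst.
apply: (squeeze_cvgr (f := (fun=> 0)) (h := (fun x => expR (- x)))).
- near=> x; rewrite expR_ge0/= ler_expR lerN2.
  have x2 : 2 <= x by near: x; exact: nbhs_pinfty_ge.
  by rewrite ler_pdivlMr// expr2 ler_wpM2l// (le_trans _ x2).
- exact: cvg_cst.
- exact: cvgr_expR.
Unshelve. all: by end_near. Qed.

Let integral_tail (x : R) : 0 <= x ->
  (\int[leb]_(t in `[x, +oo[) (t * phi t)%:E = (phi x)%:E)%E.
Proof.
move=> x0.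
rewrite (@ge0_continuous_FTC2y _ _ (fun x => - phi x) _ 0)//.
- by rewrite -EFinB opprK add0r.
- by move=> t xt; rewrite mulr_ge0 ?normal_pdf_ge0// (le_trans x0).
- apply: continuous_subspaceT => t; apply: cvgM; first exact: cvg_id.
  exact: continuous_phi.
- by move=> t _; have [] := is_derive_phi t.
- apply: cvgN; apply: cvg_at_right_filter; exact: continuous_phi.
- by move=> t _; rewrite derive1E; have [_ ->] := is_derive_phi t.
Qed.

(** Tonelli in place of an integration by parts: t^2 phi(t) is the integral of the constant t phi(t)
    over x in [0, t], and after the exchange the inner integral over t >= x is phi(x) by
    [integral_tail]. *)
Let half_second_moment :
  (\int[leb]_(x in `[0%R, +oo[) (x ^+ 2 * phi x)%:E =
   \int[leb]_(x in `[0%R, +oo[) (phi x)%:E)%E.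
Proof.
pose f (u : R * R) : \bar R :=
  ((0 <= u.1)%R%:R * (u.1 <= u.2)%R%:R * (u.2 * phi u.2))%:E.
have f0 u : (0 <= f u)%E.
  rewrite lee_fin; have [u1|] := boolP (0 <= u.1); last by rewrite !mul0r.
  have [u2|] := boolP (u.1 <= u.2); last by rewrite mulr0 mul0r.
  by rewrite !mul1r mulr_ge0 ?normal_pdf_ge0// (le_trans u1).
have mf : measurable_fun setT f.
  apply/measurable_EFinP; apply: measurable_funM.
    apply: measurable_funM; apply: (measurableT_comp (f := fun b : bool => b%:R : R)) => //.
    - apply: measurable_fun_ler => //; exact: measurable_fst.
    - apply: measurable_fun_ler => //.
  apply: measurable_funM => //.
  exact: measurableT_comp (measurable_normal_pdf 0 1) measurable_snd.
transitivity (\int[leb]_t \int[leb]_x f (x, t))%E.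
  rewrite integral_mkcond; apply: eq_integral => t _.
  rewrite patchE mem_setE in_itv/= andbT; case: ifPn => [t0|t0].
    transitivity (\int[leb]_(x in `[0%R, t]) (t * phi t)%:E)%E.
      rewrite integral_cst//= lebesgue_measure_itv/= lte_fin.
      have [t_gt0|] := ltP 0 t; last first.
        by move=> t_le0; rewrite (_ : t = 0) ?expr0n ?mul0r ?mule0//; apply/eqP; rewrite eq_le t_le0.
      by rewrite -EFinB -EFinM subr0 expr2 mulrAC.
    rewrite integral_mkcond; apply: eq_integral => x _.
    rewrite patchE mem_setE in_itv/= /f/=.
    by case: (0 <= x); case: (x <= t); rewrite /= ?(mul1r, mul0r, mulr0).
  rewrite integral0_eq// => x _; rewrite /f/=.
  have [x0|] := boolP (0 <= x); last by rewrite !mul0r.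
  have [xt|] := boolP (x <= t); last by rewrite mulr0 mul0r.
  by rewrite (le_trans x0 xt) in t0.
transitivity (\int[leb]_x \int[leb]_t f (x, t))%E.
  exact/esym/(@fubini_tonelli _ _ _ _ _ leb leb f mf f0).
rewrite [RHS]integral_mkcond; apply: eq_integral => x _.
rewrite patchE mem_setE in_itv/= andbT; case: ifPn => [x0|x0].
  rewrite -integral_tail// [RHS]integral_mkcond; apply: eq_integral => t _.
  rewrite patchE mem_setE in_itv/= andbT /f/= x0 mul1r.
  by case: ifPn; rewrite ?mul1r ?mul0r.
by rewrite integral0_eq// => t _; rewrite /f/= (negbTE x0) !mul0r.
Qed.

Lemma normal_second_moment : (\int[normal_prob 0 1]_x ((x : R) ^+ 2)%:E = 1)%E.
Proof.
rewrite ge0_integral_normal//; first last.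
- by move=> x; rewrite lee_fin sqr_ge0.
- by apply/measurable_EFinP; exact: measurable_funX.
under eq_integral do rewrite -EFinM.
have cphi2 : continuous (fun x : R => x ^+ 2 * phi x).
  move=> t; apply: cvgM; [exact: exprn_continuous|exact: continuous_phi].
rewrite ge0_symfun_integralT//; first last.
- by move=> x /=; rewrite !phiE sqrrN.
- by move=> x; rewrite mulr_ge0 ?sqr_ge0 ?normal_pdf_ge0.
rewrite -[RHS](@integral_normal_pdf R 0 1) ge0_symfun_integralT//; first last.
- by move=> x /=; rewrite !phiE sqrrN.
- by move=> x; rewrite normal_pdf_ge0.
by rewrite -set_itvcy half_second_moment.
Qed.

End normal_moments.

Section gauss_moments.
Context {R : realType}.

Lemma Lfun2_integral_sqr d (T : measurableType d) (mu : {measure set T -> \bar R})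
    (f : T -> R) : measurable_fun setT f -> (\int[mu]_x (f x ^+ 2)%:E < +oo)%E ->
  f \in Lfun mu 2%:E.
Proof.
move=> mf foo; rewrite inE; apply/andP; split; rewrite inE//= /finite_norm unlock.
rewrite (_ : (\int[mu]_x _)%E = (\int[mu]_x (f x ^+ 2)%:E)%E); last first.
  by apply: eq_integral => x _; rewrite /= powR_mulrn// real_normK// num_real.
exact: poweR_lty.
Qed.

Let Lfun2_affine (m s : R) : (fun z => m + s * z) \in Lfun (normal_prob 0 1) 2%:E.
Proof.
apply: Lfun2_integral_sqr; first exact: measurable_affine.
pose N : probability (measurableTypeR R) R := normal_prob 0 1.
have twice_sqr (x : R) : 0 <= 2 * x ^+ 2 by rewrite pmulr_rge0 ?sqr_ge0.
have mz : measurable_fun setT (fun z : R => (2 * s ^+ 2) * z ^+ 2).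
  by apply: measurable_funM => //; exact: measurable_funX.
apply: (@le_lt_trans _ _ (\int[N]_z (2 * m ^+ 2 + (2 * s ^+ 2) * z ^+ 2)%:E))%E.
  apply: ge0_le_integral => //.
  - by move=> z _; rewrite lee_fin sqr_ge0.
  - by apply/measurable_EFinP; apply: measurable_funX; exact: measurable_affine.
  - by apply/measurable_EFinP; exact: measurable_funD.
  - move=> z _; rewrite lee_fin -subr_ge0.
    by rewrite (_ : _ - _ = (m - s * z) ^+ 2) ?sqr_ge0//; ring.
under eq_integral do rewrite EFinD.
rewrite ge0_integralD//; first last.
- exact/measurable_EFinP.
- by move=> z _; rewrite lee_fin mulr_ge0 ?twice_sqr// sqr_ge0.
- by move=> z _; rewrite lee_fin twice_sqr.
under [X in (_ + X)%E]eq_integral do rewrite EFinM.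
rewrite ge0_integralZl//; first last.
- by rewrite lee_fin twice_sqr.
- by move=> x _; rewrite lee_fin sqr_ge0.
- by apply/measurable_EFinP; exact: measurable_funX.
rewrite [X in (_ + _ * X)%E]normal_second_moment mule1 integral_cst//=.
by rewrite [X in (_ * X)%E](_ : _ = 1%E) ?mule1 ?ltry//; exact: (probability_setT N).
Qed.

(** The standard normal law is symmetric, so its mean, which is finite, equals its opposite. *)
Lemma normal_mean : (\int[normal_prob 0 1]_x (x : R)%:E = 0)%E.
Proof.
pose N : probability (measurableTypeR R) R := normal_prob 0 1.
have id1 : N.-integrable setT (EFin \o id).
  have := Lfun2_affine 0 1; rewrite (_ : (fun z => _) = id); last first.
    by apply/funext => z; rewrite add0r mul1r.
  by move=> /(Lfun_subset12 (fin_num_measure N _ measurableT)) /Lfun1_integrable.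
have fin := integrable_fin_num measurableT id1.
have mN : measurable_fun setT (fun z : R => 0 + -1 * z) by exact: measurable_affine.
have E : (\int[N]_x (x : R)%:E = - \int[N]_x x%:E)%E.
  rewrite -[RHS]integralN//; last exact: integrable_add_def.
  transitivity (\int[N]_z (0 + -1 * z)%:E)%E; last first.
    by apply: eq_integral => x _; rewrite /= add0r mulN1r EFinN.
  refine (@integral_eq_law R _ _ _ _ _ R N N id _ (@measurable_id _ _ _) mN _ EFin _) => // A mA.
  transitivity (gauss 0 1 A); last by apply: gauss_sqr; rewrite ?sqrrN.
  by rewrite /gauss; congr normal_prob; apply/seteqP; split => z /=; rewrite add0r mul1r.
move: fin E; rewrite /=; case: (\int[N]_x x%:E)%E => // r _ [] /eqP.
by rewrite -subr_eq0 opprK -mulr2n mulrn_eq0/= => /eqP ->.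
Qed.

Context d (T : measurableType d) (P : probability T R) (U : {RV P >-> R}) (m s : R).
Hypothesis lawU : forall A, measurable A -> P (U @^-1` A) = gauss m s A.

Lemma ge0_integral_gauss (g : R -> \bar R) : measurable_fun setT g ->
  (forall x, 0 <= g x)%E ->
  (\int[P]_w g (U w) = \int[normal_prob 0 1]_z g (m + s * z)%R)%E.
Proof.
move=> mg g0.
exact: (@ge0_integral_eq_law R _ _ _ _ _ _ P (normal_prob 0 1) _ _
  (measurable_funPT U) (measurable_affine m s) lawU g mg g0).
Qed.

Lemma gauss_Lfun2 : (U : T -> R) \in Lfun P 2%:E.
Proof.
apply: Lfun2_integral_sqr; first exact: measurable_funPT.
rewrite (@ge0_integral_gauss (fun x => (x ^+ 2)%:E)).
- have /Lfun2_integrable_sqr := Lfun2_affine m s.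
  by move=> /integrable_lty; apply.
- by apply/measurable_EFinP; exact: measurable_funX.
- by move=> x; rewrite lee_fin sqr_ge0.
Qed.

Lemma gauss_expectation : ('E_P[U] = m%:E)%E.
Proof.
pose N : probability (measurableTypeR R) R := normal_prob 0 1.
have mU := measurable_funPT U.
have ma := measurable_affine m s.
have U1 : P.-integrable setT (EFin \o U).
  by apply/Lfun1_integrable/(Lfun_subset12 (fin_num_measure P _ measurableT))/gauss_Lfun2.
have a1 : N.-integrable setT (EFin \o (fun z => m + s * z)).
  by apply/Lfun1_integrable/(Lfun_subset12 (fin_num_measure N _ measurableT))/Lfun2_affine.
have id1 : N.-integrable setT (EFin \o id).
  have := Lfun2_affine 0 1; rewrite (_ : (fun z => _) = id); last first.
    by apply/funext => z; rewrite add0r mul1r.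
  by move=> /(Lfun_subset12 (fin_num_measure N _ measurableT)) /Lfun1_integrable.
rewrite unlock.
transitivity (\int[N]_z (m + s * z)%:E)%E.
  exact: (@integral_eq_law R _ _ _ _ _ _ P N _ _ mU ma lawU EFin).
transitivity (\int[N]_x ((cst m%:E \+ (fun x => s%:E * (EFin \o id) x)) x))%E.
  by apply: eq_integral => x _; rewrite /= EFinD EFinM.
rewrite integralD//; last 2 first.
- by apply: finite_measure_integrable_cst.
- exact: integrableZl.
rewrite integralZl// [X in (_ + s%:E * X)%E]normal_mean mule0 adde0 integral_cst//=.
by rewrite [X in (_ * X)%E](_ : _ = 1%E) ?mule1//; exact: (probability_setT N).
Qed.

Lemma gauss_variance : ('V_P[U] = (s ^+ 2)%:E)%E.
Proof.
rewrite /variance [in LHS]unlock gauss_expectation/= unlock.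
transitivity (\int[P]_w (((fun x => (x - m) ^+ 2) (U w))%:E))%E.
  by apply: eq_integral => w _.
rewrite (@ge0_integral_gauss (fun x => ((x - m) ^+ 2)%:E)).
- under eq_integral do rewrite addrC addKr exprMn EFinM.
  rewrite ge0_integralZl//.
  + by rewrite normal_second_moment mule1.
  + by apply/measurable_EFinP; exact: measurable_funX.
  + by move=> x _; rewrite lee_fin sqr_ge0.
  + by rewrite lee_fin sqr_ge0.
- by apply/measurable_EFinP; apply: measurable_funX; exact: measurable_funB.
- by move=> x; rewrite lee_fin sqr_ge0.
Qed.

End gauss_moments.

(** * Bivariate Gaussian laws *)

Section bivariate_gauss.
Context {R : realType}.
Implicit Types r m s a b : R.

(* [normal_prob] lives on [measurableTypeR R], whose display is not that of [R] *)
Definition of_measurableTypeR (x : measurableTypeR R) : R := x.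

Lemma measurable_of_measurableTypeR : measurable_fun setT of_measurableTypeR.
Proof. exact: measurable_id. Qed.

HB.instance Definition _ :=
  isMeasurableFun.Build _ _ _ _ of_measurableTypeR measurable_of_measurableTypeR.

Definition std_normal : probability R R :=
  distribution (normal_prob 0 1) of_measurableTypeR.

Lemma integral_std_normal (f : R -> \bar R) : measurable_fun setT f ->
  (\int[std_normal]_x f x = \int[normal_prob 0 1]_x f x)%E.
Proof.
move=> mf.
exact: (@integral_eq_law R _ _ _ _ _ _ std_normal (normal_prob 0 1) _ _
  (@measurable_id _ _ _) measurable_of_measurableTypeR _ f).
Qed.

Local Notation N := std_normal.

Definition affine m s (z : R) : R := m + s * z.

HB.instance Definition _ m s :=
  isMeasurableFun.Build _ _ R R (affine m s) (measurable_affine m s).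

HB.instance Definition _ m s := Probability.copy (gauss m s) (distribution N (affine m s)).

(** The conditional law of the second coordinate given the first, in a standard Gaussian pair of
    correlation r; for r = exp(-t) it is the Ornstein-Uhlenbeck (Mehler) transition. *)
Definition gauss_kernel r (x : R) : {measure set R -> \bar R} :=
  gauss (r * x) (Num.sqrt (1 - r ^+ 2)).

Let measurable_gauss_kernel r U : measurable U ->
  measurable_fun setT (gauss_kernel r ^~ U).
Proof.
move=> mU; have := measurable_gauss 0 r (Num.sqrt (1 - r ^+ 2)) mU.
by congr (measurable_fun _ _); apply/funext => x; rewrite add0r.
Qed.

HB.instance Definition _ r :=
  isKernel.Build _ _ _ _ R (gauss_kernel r) (measurable_gauss_kernel r).

Let gauss_kernel_setT r x : gauss_kernel r x setT = 1%E.
Proof. exact: probability_setT. Qed.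

HB.instance Definition _ r :=
  Kernel_isProbability.Build _ _ _ _ R (gauss_kernel r) (gauss_kernel_setT r).

(** Turns two independent standard normal variables into a pair of correlation r. For |r| > 1 the
    square root takes its default value 0, and r is no longer a correlation. *)
Definition correlate r (u : R * R) : R * R :=
  (u.1, r * u.1 + Num.sqrt (1 - r ^+ 2) * u.2).

Lemma measurable_correlate r : measurable_fun setT (correlate r).
Proof.
apply: measurable_fun_pair => //.
by apply: measurable_funD; apply: measurable_funM.
Qed.

HB.instance Definition _ r :=
  isMeasurableFun.Build _ _ (R * R)%type (R * R)%type (correlate r) (measurable_correlate r).

Definition bigauss r : probability (R * R)%type R :=
  distribution (N \x N)%E (correlate r).

Lemma bigaussE r A : measurable A ->
  (bigauss r A = \int[N]_x gauss_kernel r x (xsection A x))%E.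
Proof. by []. Qed.

Lemma gauss_std m s A : gauss m s A = N ((fun z => m + s * z) @^-1` A).
Proof. by []. Qed.

Lemma gauss_mix m a b A : measurable A ->
  (\int[N]_x gauss (m + a * x) b A = gauss m (Num.sqrt (a ^+ 2 + b ^+ 2)) A)%E.
Proof.
move=> mA; rewrite integral_std_normal ?gauss_convolution//.
exact: measurable_gauss.
Qed.

(** Given u.1 = x, the form is Gaussian with mean (a + b r) x and deviation b sqrt(1 - r^2);
    averaging over x adds squares by [gauss_mix]. *)
Lemma bigauss_lin r a b A : `|r| <= 1 -> measurable A ->
  bigauss r ((fun u => a * u.1 + b * u.2) @^-1` A) =
  gauss 0 (Num.sqrt (a ^+ 2 + b ^+ 2 + 2 * a * b * r)) A.
Proof.
move=> r1 mA; have r21 : 0 <= 1 - r ^+ 2 by rewrite subr_ge0 -real_normK ?num_real// expr_le1.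
have -> : a ^+ 2 + b ^+ 2 + 2 * a * b * r =
    (a + b * r) ^+ 2 + (b * Num.sqrt (1 - r ^+ 2)) ^+ 2.
  by rewrite exprMn sqr_sqrtr//; ring.
rewrite -gauss_mix// bigaussE; last first.
  rewrite -[X in measurable X]setTI.
  apply: (_ : measurable_fun setT (fun u : R * R => a * u.1 + b * u.2)) => //.
  by apply: measurable_funD; apply: measurable_funM.
apply: eq_integral => x _; rewrite /gauss_kernel /=/gauss; congr normal_prob.
by apply/seteqP; split => z /=; rewrite /xsection/= inE/=; congr (A _); ring.
Qed.

Lemma bigauss_unique r (Q : probability (R * R)%type R) : `|r| <= 1 ->
  (forall a b A, measurable A -> Q ((fun u => a * u.1 + b * u.2) @^-1` A) =
    gauss 0 (Num.sqrt (a ^+ 2 + b ^+ 2 + 2 * a * b * r)) A) ->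
  forall A, measurable A -> Q A = bigauss r A.
Proof.
by move=> r1 QE; apply: cramer_wold => a b A mA; rewrite bigauss_lin// QE.
Qed.

Lemma pushforward_fst_bigauss r A : measurable A ->
  pushforward (bigauss r) fst A = N A.
Proof.
move=> mA; rewrite /pushforward bigaussE; last first.
  by rewrite -[X in measurable X]setTI; exact: measurable_fst.
rewrite -[X in N X]setIT -integral_indic//; apply: eq_integral => x _.
rewrite indicE; case: (boolP (x \in A)) => xA.
  rewrite (_ : xsection _ _ = setT) ?probability_setT//.
  by apply/seteqP; split => // y _; rewrite /xsection/= inE/=; exact: set_mem.
rewrite (_ : xsection _ _ = set0) ?measure0//.
by apply/seteqP; split => // y; rewrite /xsection/= inE/= => /mem_set; rewrite (negbTE xA).
Qed.

Lemma disintegrates_bigauss r : disintegrates (bigauss r) (gauss_kernel r).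
Proof.
move=> A mA; rewrite bigaussE//.
transitivity (\int[N]_x \int[gauss_kernel r x]_y (\1_A (x, y))%:E)%E.
  apply: eq_integral => x _.
  rewrite -[X in gauss_kernel _ _ X]setIT -integral_indic//; last exact: measurable_xsection.
  by apply: eq_integral => y _; rewrite !indicE mem_xsection.
by apply: eq_measure_integral => B mB _; exact/esym/pushforward_fst_bigauss.
Qed.

End bivariate_gauss.

Section continuous_measurable.
Context {R : realType}.

(** An open set of the plane is a countable union of rectangles with rational corners. This makes
    the test functions of weak convergence measurable for the product sigma-algebra. *)
Lemma open_measurable_prod (A : set (R * R)) : open A -> measurable A.
Proof.
move=> oA.
pose B (p : (rat * rat) * (rat * rat)) : set (R * R) :=
  `](ratr p.1.1 : R), ratr p.1.2[%classic `*` `](ratr p.2.1 : R), ratr p.2.2[%classic.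
have -> : A = \bigcup_(p in [set p | B p `<=` A]) B p.
  apply/seteqP; split=> [x Ax|x [p pA Bx]]; last exact: pA.
  have /nbhs_ballP[e /= e0 eA] : nbhs x A by exact: open_nbhs_nbhs.
  have [p1] : exists q, ratr q \in `]x.1 - e, x.1[ by apply: rat_in_itvoo; rewrite ltrBlDr ltrDl.
  have [p2] : exists q, ratr q \in `]x.1, x.1 + e[ by apply: rat_in_itvoo; rewrite ltrDl.
  have [p3] : exists q, ratr q \in `]x.2 - e, x.2[ by apply: rat_in_itvoo; rewrite ltrBlDr ltrDl.
  have [p4] : exists q, ratr q \in `]x.2, x.2 + e[ by apply: rat_in_itvoo; rewrite ltrDl.
  rewrite !in_itv/= => /andP[h1 h2] /andP[h3 h4] /andP[h5 h6] /andP[h7 h8].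
  exists ((p1, p2), (p3, p4)); last by rewrite /B/= !in_itv/=; split; apply/andP.
  move=> y; rewrite /B/= !in_itv/= => -[/andP[y1 y2] /andP[y3 y4]].
  apply: eA; split; rewrite /ball/= ltr_distl ltrBlDr -[X in _ && X]ltrBlDr.
    by rewrite (lt_trans y2 h6) (lt_trans h7 y1).
  by rewrite (lt_trans y4 h2) (lt_trans h3 y3).
rewrite bigcup_mkcond; apply: countable_bigcupT_measurable.
  exact: countableP.
by move=> p; case: ifPn => // _; apply: measurableX; exact: measurable_itv.
Qed.

Lemma continuous_measurable_fun_prod (f : R * R -> R) : continuous f ->
  measurable_fun setT f.
Proof.
move=> /continuousP cf; apply: (measurability _ (RGenOpens.measurableE R)).
move=> _ [_ [a [b ->] <-]]; rewrite setTI; apply: open_measurable_prod.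
exact/cf/interval_open.
Qed.

End continuous_measurable.

Section bigauss_limits.
Context {R : realType}.

Lemma integral_bigauss (r : R) (f : R * R -> \bar R) : measurable_fun setT f ->
  (\int[bigauss r]_x f x = \int[(std_normal \x std_normal)%E]_u f (correlate r u))%E.
Proof.
move=> mf; exact: (@integral_eq_law R _ _ _ _ _ _ (bigauss r) (std_normal \x std_normal)%E
  id (correlate r) (@measurable_id _ _ _) (measurable_correlate r) (fun _ _ => erefl) f mf).
Qed.

Lemma correlate_cvg (r_ : nat -> R) (r : R) (f : R * R -> R) x :
  r_ @ \oo --> r -> continuous f -> f (correlate (r_ n) x) @[n --> \oo] --> f (correlate r x).
Proof.
move=> rr cf; apply: (cvg_comp _ f); last exact: cf.
apply: (cvg_pair (F := \oo) (G := nbhs x.1) (H := nbhs (r * x.1 + Num.sqrt (1 - r ^+ 2) * x.2))).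
  exact: cvg_cst.
apply: cvgD; first by apply: cvgM => //; exact: cvg_cst.
apply: cvgM; last exact: cvg_cst.
apply: (cvg_comp _ Num.sqrt); last exact: sqrt_continuous.
apply: cvgB; first exact: cvg_cst.
by apply: (cvg_comp _ (fun x => x ^+ 2)); [exact: rr|exact: exprn_continuous].
Qed.

(** All the laws [bigauss r] are images of one measure under [correlate r], which depends
    continuously on r: weak convergence reduces to bounded convergence on a fixed space. *)
Lemma bigauss_cvg (r_ : nat -> R) (r : R) (f : R * R -> R) :
  r_ @ \oo --> r -> continuous f -> (exists M, forall x, `|f x| <= M) ->
  (\int[bigauss (r_ n)]_x (f x)%:E @[n --> \oo] --> \int[bigauss r]_x (f x)%:E)%E.
Proof.
move=> rr cf [M fM]; have mf := continuous_measurable_fun_prod cf.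
have mf' := (measurable_EFinP _ _).2 mf.
have E s : (\int[bigauss s]_x (f x)%:E =
    \int[(std_normal \x std_normal)%E]_u (f (correlate s u))%:E)%E.
  exact: integral_bigauss mf'.
have transfer (F G : R -> \bar R) : (forall s, F s = G s) ->
    (G (r_ n) @[n --> \oo] --> G r) -> F (r_ n) @[n --> \oo] --> F r.
  by move=> /funext ->.
refine (transfer (fun s => \int[bigauss s]_x (f x)%:E)%E _ E _).
have mfc n : measurable_fun setT (fun u => f (correlate (r_ n) u)).
  exact: measurableT_comp mf (measurable_correlate _).
refine (@bounded_probability_cvg R _ _ (std_normal \x std_normal)%E
  (fun n u => f (correlate (r_ n) u)) (fun u => f (correlate r u)) M mfc _ _).
  by move=> n x; exact: fM.
by move=> x; exact: correlate_cvg.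
Qed.

Lemma bigauss_limit (r : R) (Q : probability (R * R)%type R) :
  (forall f : R * R -> R, continuous f -> (exists M, forall x, `|f x| <= M) ->
    (\int[Q]_x (f x)%:E = \int[bigauss r]_x (f x)%:E)%E) ->
  forall A, measurable A -> Q A = bigauss r A.
Proof.
move=> H; apply: trigonometric_unique => a b c; apply: H.
  move=> x; apply: (cvg_comp _ cos); last exact: continuous_cos.
  apply: cvgD; last exact: cvg_cst.
  by apply: cvgD; apply: cvgM; [exact: cvg_cst|exact: cvg_fst|exact: cvg_cst|exact: cvg_snd].
by exists 1 => x; exact: cos_max.
Qed.

End bigauss_limits.

(** * Chains of kernels *)

Section kernel_integral_theory.
Context {R : realType}.
Local Open Scope ereal_scope.

Section kernel_precomposition.
Context d (S : measurableType d) (k : R.-pker R ~> R) (g : S -> R).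
Hypothesis mg : measurable_fun setT g.

(** The measurability proof is an argument so that the kernel structure can be attached to the
    function. *)
Definition kernel_precomp of measurable_fun setT g :=
  fun s => k (g s) : {measure set R -> \bar R}.

Let measurable_kernel_precomp U : measurable U ->
  measurable_fun setT (kernel_precomp mg ^~ U).
Proof. by move=> mU; exact: measurableT_comp (measurable_kernel k U mU) mg. Qed.

HB.instance Definition _ :=
  isKernel.Build _ _ S R R (kernel_precomp mg) measurable_kernel_precomp.

Let kernel_precomp_setT s : kernel_precomp mg s setT = 1.
Proof. exact: prob_kernel. Qed.

HB.instance Definition _ :=
  Kernel_isProbability.Build _ _ S R R (kernel_precomp mg) kernel_precomp_setT.

End kernel_precomposition.

Lemma measurable_integral_kernel d (S : measurableType d) (k : R.-pker R ~> R)
    (g : S -> R) (h : S * R -> \bar R) :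
  measurable_fun setT g -> (forall u, 0 <= h u) -> measurable_fun setT h ->
  measurable_fun setT (fun s => \int[k (g s)]_y h (s, y)).
Proof.
move=> mg h0 mh.
exact: (@measurable_fun_integral_sfinite_kernel _ _ S R R h (kernel_precomp k mg) h0 mh).
Qed.

Lemma kernel_integralS n (k : 'I_n.+1 -> R.-pker R ~> R) x (f : n.+1.-tuple R -> \bar R) :
  kernel_integral k x f = \int[k ord0 x]_y
    kernel_integral (fun i => k (lift ord0 i)) y (fun v => f (cons_tuple y v)).
Proof. by []. Qed.

Lemma eq_kernel_integral n (k : 'I_n -> R.-pker R ~> R) x (f g : n.-tuple R -> \bar R) :
  f =1 g -> kernel_integral k x f = kernel_integral k x g.
Proof. by move=> /funext ->. Qed.

Lemma kernel_integral_ge0 n (k : 'I_n -> R.-pker R ~> R) x (f : n.-tuple R -> \bar R) :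
  (forall v, 0 <= f v) -> 0 <= kernel_integral k x f.
Proof.
elim: n => [|n IH] in k x f *; first by move=> f0 /=.
by move=> f0 /=; apply: integral_ge0 => y _; exact: IH.
Qed.

(** The parameter space [S] is arbitrary because the induction moves the first integration variable
    into it, replacing [S] by [S * R]. *)
Lemma measurable_kernel_integral n (k : 'I_n -> R.-pker R ~> R) d
    (S : measurableType d) (g : S -> R) (F : S * n.-tuple R -> \bar R) :
  measurable_fun setT g -> (forall u, 0 <= F u) -> measurable_fun setT F ->
  measurable_fun setT (fun s => kernel_integral k (g s) (fun v => F (s, v))).
Proof.
elim: n => [|n IH] in k d S g F *; move=> mg F0 mF /=.
  by apply: measurableT_comp mF _; exact: measurable_fun_pair.
apply: (@measurable_integral_kernel _ _ (k ord0) g (fun u : S * R =>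
  kernel_integral (fun i => k (lift ord0 i)) u.2 (fun v => F (u.1, cons_tuple u.2 v)))) => //.
  by move=> u; exact: kernel_integral_ge0.
pose G (w : (S * R) * n.-tuple R) := F (w.1.1, cons_tuple w.1.2 w.2).
apply: (IH _ _ _ snd G) => //; first by move=> u; exact: F0.
apply: measurableT_comp mF _; apply: measurable_fun_pair.
  exact: measurableT_comp measurable_fst measurable_fst.
apply: measurable_cons; last exact: measurable_snd.
exact: measurableT_comp measurable_snd measurable_fst.
Qed.

Lemma measurable_cons_tuple n : measurable_fun setT
  (fun u : R * n.-tuple R => cons_tuple u.1 u.2).
Proof. by apply: measurable_cons. Qed.

Lemma measurable_kernel_integral_cons n (k : 'I_n -> R.-pker R ~> R)
    (f : n.+1.-tuple R -> \bar R) :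
  (forall v, 0 <= f v) -> measurable_fun setT f ->
  measurable_fun setT (fun x => kernel_integral k x (fun v => f (cons_tuple x v))).
Proof.
move=> f0 mf.
apply: (@measurable_kernel_integral n k _ _ id (fun u => f (cons_tuple u.1 u.2))) => //.
exact: measurableT_comp mf (@measurable_cons_tuple n).
Qed.

Lemma measurable_cons_tuplel n (x : R) : measurable_fun setT
  (fun v : n.-tuple R => cons_tuple x v).
Proof. by apply: measurable_cons. Qed.

Lemma kernel_integral_nneseries n (k : 'I_n -> R.-pker R ~> R) x
    (f : nat -> n.-tuple R -> \bar R) :
  (forall i v, 0 <= f i v) -> (forall i, measurable_fun setT (f i)) ->
  kernel_integral k x (fun v => \sum_(i <oo) f i v) =
  \sum_(i <oo) kernel_integral k x (f i).
Proof.
elim: n => [|n IH] in k x f *; move=> f0 mf //=.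
rewrite -integral_nneseries//.
- apply: eq_integral => y _; rewrite IH// => i.
  exact: measurableT_comp (mf i) (@measurable_cons_tuplel n y).
- by move=> i; exact: measurable_kernel_integral_cons.
- by move=> i y _; exact: kernel_integral_ge0.
Qed.

Lemma kernel_integral_cst1 n (k : 'I_n -> R.-pker R ~> R) x :
  kernel_integral k x (fun=> 1) = 1.
Proof.
elim: n => [//|n IH] in k x *; rewrite /=.
under eq_integral do rewrite IH.
by rewrite integral_cst//= mul1e; exact: prob_kernel.
Qed.

End kernel_integral_theory.

Section chain_law.
Context {R : realType} n (mu : probability R R) (k : 'I_n -> R.-pker R ~> R).
Local Open Scope ereal_scope.

(** The law of the Markov chain started from [mu] with transitions [k]. It is made a probability
    below because [is_composition] asks for one as a witness. *)
Definition chain_law (B : set (n.+1.-tuple R)) : \bar R :=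
  \int[mu]_x kernel_integral k x (fun v => (\1_B (cons_tuple x v))%:E).

Let chain_law0 : chain_law set0 = 0.
Proof.
rewrite /chain_law integral0_eq// => x _.
under eq_fun do rewrite indic0.
elim: n k x => [//|m IH] k' x /=; by rewrite integral0_eq// => y _; exact: IH.
Qed.

Let chain_law_ge0 B : 0 <= chain_law B.
Proof.
apply: integral_ge0 => x _; apply: kernel_integral_ge0 => v.
by rewrite lee_fin.
Qed.

Let chain_law_sigma_additive : semi_sigma_additive chain_law.
Proof.
move=> F mF tF mUF.
have mind i : measurable_fun setT (fun v : n.+1.-tuple R => (\1_(F i) v : R)%:E).
  exact/measurable_EFinP.
rewrite [X in _ --> X](_ : _ = \sum_(i <oo) chain_law (F i)).
  by apply: is_cvg_ereal_nneg_natsum => i _; exact: chain_law_ge0.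
rewrite /chain_law -integral_nneseries//.
- apply: eq_integral => x _; rewrite -kernel_integral_nneseries//.
  + by apply: eq_kernel_integral => v; rewrite indic_bigcup.
  + by move=> i; exact: measurableT_comp (mind i) (@measurable_cons_tuplel R n x).
- move=> i; apply: (@measurable_kernel_integral_cons R n k (fun v => (\1_(F i) v)%:E) _ (mind i)).
  by move=> v; rewrite lee_fin.
- by move=> i x _; apply: kernel_integral_ge0.
Qed.

HB.instance Definition _ := isMeasure.Build _ _ _ chain_law
  chain_law0 chain_law_ge0 chain_law_sigma_additive.

Let chain_law_setT : chain_law setT = 1.
Proof.
rewrite /chain_law; under eq_integral => x _.
  under eq_fun do rewrite indicT.
  rewrite kernel_integral_cst1; over.
by rewrite integral_cst//= mul1e; exact: probability_setT.
Qed.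

HB.instance Definition _ := Measure_isProbability.Build _ _ _ chain_law chain_law_setT.

End chain_law.

(** * Almost sure uniqueness of disintegrations *)

Section kernel_uniqueness.
Context {R : realType}.
Local Open Scope ereal_scope.

(** The ray from p is the increasing union of the rays from p + 1 / (n + 1), and a rational ray fits
    between each of these and the ray from p. Rational endpoints matter because only countably many
    almost sure equalities can be combined. *)
Lemma measure_rat_rays_le (m1 m2 : {measure set R -> \bar R}) :
  (forall q : rat, m1 `](ratr q : R), +oo[%classic = m2 `](ratr q : R), +oo[%classic) ->
  forall p : R, m1 `]p, +oo[%classic <= m2 `]p, +oo[%classic.
Proof.
move=> m12 p; pose F n : set R := `](p + n.+1%:R^-1)%R, +oo[%classic.
have UF : \bigcup_n F n = `]p, +oo[%classic.
  apply/seteqP; split=> [x [n _]|x]; rewrite /F/= !in_itv/= !andbT.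
    by apply: lt_trans; rewrite ltrDl invr_gt0.
  rewrite -subr_gt0 => xp; have [n _ /(_ _ (leqnn n)) /= h] := near_infty_natSinv_lt (PosNum xp).
  by exists n => //; rewrite /F/= in_itv/= andbT -ltrBrDl.
have ndF : nondecreasing_seq F.
  move=> n m nm; apply/subsetPset => x; rewrite /F/= !in_itv/= !andbT.
  by apply: le_lt_trans; rewrite lerD2l lef_pV2 ?posrE// ler_nat ltnS.
have mF n : measurable (F n) by exact: measurable_itv.
have Fcvg : m1 (F n) @[n --> \oo] --> m1 `]p, +oo[%classic.
  by rewrite -UF; apply: nondecreasing_cvg_mu => //; rewrite UF.
rewrite -(cvg_lim _ Fcvg)//; apply: lime_le; first exact: cvgP Fcvg.
apply: nearW => n.
have /rat_in_itvoo[q] : (p < p + n.+1%:R^-1)%R by rewrite ltrDl invr_gt0.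
rewrite in_itv/= => /andP[pq qp].
apply: (@le_trans _ _ (m2 `](ratr q : R), +oo[%classic)).
  rewrite -m12; apply: le_measure; rewrite ?inE//.
  by move=> x; rewrite /F/= !in_itv/= !andbT; exact: lt_trans.
apply: le_measure; rewrite ?inE//.
by move=> x; rewrite /= !in_itv/= !andbT; exact: lt_trans.
Qed.

Lemma measure_unique_rat_rays (m1 m2 : {measure set R -> \bar R}) :
  m1 setT = 1 ->
  (forall q : rat, m1 `](ratr q : R), +oo[%classic = m2 `](ratr q : R), +oo[%classic) ->
  forall A, measurable A -> m1 A = m2 A.
Proof.
move=> m1T m12; apply: measure_uniqueR => p.
  by rewrite (@le_lt_trans _ _ (m1 setT)) ?le_measure ?inE// m1T ltry.
by apply/eqP; rewrite eq_le !measure_rat_rays_le.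
Qed.

Lemma ae_rat d (T : measurableType d) (mu : {measure set T -> \bar R})
    (P : rat -> T -> Prop) :
  (forall q, \forall x \ae mu, P q x) -> \forall x \ae mu, forall q, P q x.
Proof.
move=> H; have : \forall x \ae mu, forall n : nat, if unpickle n is Some q then P q x else True.
  apply: ae_foralln => n; case: (unpickle n) => [q|]; first exact: H.
  exact: aeW.
by apply: filterS => x h q; have := h (pickle q); rewrite pickleK.
Qed.

(** For a fixed ray B, the functions k x B and k' x B of x have the same integral over every S,
    namely the mass of the rectangle with sides S and B, hence agree almost everywhere. Countably
    many rays determine the kernels. *)
Lemma disintegrates_ae_unique (P : probability (R * R)%type R)
    (k k' : R.-pker R ~> R) (mu : probability R R) :
  (forall A, measurable A -> pushforward P fst A = mu A) ->
  disintegrates P k -> disintegrates P k' ->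
  \forall x \ae mu, forall A, measurable A -> k x A = k' x A.
Proof.
move=> Pmu dk dk'.
have H (q : rat) : \forall x \ae mu,
    k x `](ratr q : R), +oo[%classic = k' x `](ratr q : R), +oo[%classic.
  set B := `](ratr q : R), +oo[%classic.
  have mB : measurable B by exact: measurable_itv.
  have E (l : R.-pker R ~> R) S : disintegrates P l -> measurable S ->
      \int[mu]_(x in S) l x B = P (S `*` B).
    move=> dl mS; rewrite dl; last exact: measurableX.
    rewrite integral_mkcond.
    transitivity (\int[mu]_x \int[l x]_y (\1_(S `*` B) (x, y))%:E).
      apply: eq_integral => x _; rewrite patchE; case: ifPn => xS.
        rewrite -[X in l x X]setIT -integral_indic//; apply: eq_integral => y _.
        by rewrite !indicE in_setX/= xS.
      by rewrite integral0_eq// => y _; rewrite indicE in_setX/= (negbTE xS).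
    by apply: eq_measure_integral => A mA _; exact/esym/Pmu.
  have ml (l : R.-pker R ~> R) : measurable_fun setT (fun x => l x B) by exact: measurable_kernel.
  have : ae_eq mu setT (fun x => k x B) (fun x => k' x B).
    apply: integral_ae_eq => //; last by move=> S _ mS; rewrite !E.
    apply/integrableP; split => //.
    rewrite (eq_integral (fun x => k x B))//; last by move=> x _; rewrite gee0_abs.
    rewrite E// (le_lt_trans (probability_le1 _ _)) ?ltry//; exact: measurableX.
  by apply: filterS => x /(_ Logic.I).
have := ae_rat H; apply: filterS => x h A mA.
by apply: measure_unique_rat_rays => //; exact: prob_kernel.
Qed.

(** By induction the integrals over the remaining steps agree off a null set [Z], but they are
    evaluated at the point reached after one step. Invariance of [mu] under [k'] makes this point
    avoid [Z] almost surely. *)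
Lemma kernel_integral_ae_unique n (k k' : 'I_n -> R.-pker R ~> R) (mu : probability R R) :
  (forall i, \forall x \ae mu, forall A, measurable A -> k i x A = k' i x A) ->
  (forall i A, measurable A -> \int[mu]_x k' i x A = mu A) ->
  \forall x \ae mu, forall f, measurable_fun setT f -> (forall v, 0 <= f v) ->
    kernel_integral k x f = kernel_integral k' x f.
Proof.
elim: n => [|n IH] in k k' *; first by move=> _ _; apply: aeW.
move=> kk' invk.
have [Z [mZ Z0 subZ]] := IH (fun i => k (lift ord0 i)) (fun i => k' (lift ord0 i))
  (fun i => kk' _) (fun i => invk _).
have kZ : \forall x \ae mu, k' ord0 x Z = 0.
  have mk : measurable_fun setT (fun x => k' ord0 x Z) by exact: measurable_kernel.
  have : ae_eq mu setT (fun x => k' ord0 x Z) (cst 0).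
    apply/ae_eq_integral_abs => //; rewrite -[RHS]Z0 -(invk ord0 Z mZ).
    by apply: eq_integral => x _; rewrite gee0_abs.
  by apply: filterS => x /(_ Logic.I).
move: (kk' ord0) kZ; apply: filterS2 => x kx kxZ f mf f0 /=.
transitivity (\int[k' ord0 x]_y kernel_integral (fun i => k (lift ord0 i)) y (fun v => f (cons_tuple y v))).
  by apply: eq_measure_integral => A mA _; exact: kx.
apply: ge0_ae_eq_integral => //.
- exact: measurable_kernel_integral_cons.
- exact: measurable_kernel_integral_cons.
- by move=> y _; exact: kernel_integral_ge0.
- by move=> y _; exact: kernel_integral_ge0.
exists Z; split => // y /= h; apply: subZ => /= h'; apply: h => _.
by apply: h' => //; exact: measurableT_comp mf (@measurable_cons_tuplel R n y).
Qed.

End kernel_uniqueness.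

(** * Chains of Gaussian kernels *)

Section gauss_chains.
Context {R : realType}.
Local Notation N := (@std_normal R).

Lemma integral_gauss_kernel (r x : R) (h : R -> \bar R) : measurable_fun setT h ->
  (forall y, 0 <= h y)%E ->
  (\int[gauss_kernel r x]_y h y = \int[N]_z h (r * x + Num.sqrt (1 - r ^+ 2) * z)%R)%E.
Proof.
move=> mh h0; exact: (@ge0_integral_eq_law R _ _ _ _ _ _ (gauss_kernel r x) N id _
  (@measurable_id _ _ _) (measurable_affine _ _) (fun _ _ => erefl) h mh h0).
Qed.

Lemma sqr_le1 (r : R) : `|r| <= 1 -> 0 <= 1 - r ^+ 2.
Proof. by move=> r1; rewrite subr_ge0 -real_normK ?num_real// expr_le1. Qed.

(** Conditional variances add up to r'^2 (1 - r^2) + (1 - r'^2) = 1 - (r r')^2. *)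
Lemma gauss_kernel_comp (r r' x : R) A : `|r| <= 1 -> `|r'| <= 1 -> measurable A ->
  (\int[gauss_kernel r x]_y gauss_kernel r' y A = gauss_kernel (r * r') x A)%E.
Proof.
move=> r1 r'1 mA; rewrite integral_gauss_kernel//; last exact: (measurable_kernel (gauss_kernel r') A mA).
transitivity (\int[N]_z gauss (r * r' * x + r' * Num.sqrt (1 - r ^+ 2) * z)
   (Num.sqrt (1 - r' ^+ 2)) A)%E.
  apply: eq_integral => z _; rewrite /gauss_kernel/=.
  by rewrite (_ : r' * (_ + _) = r * r' * x + r' * Num.sqrt (1 - r ^+ 2) * z)//; ring.
rewrite gauss_mix// /gauss_kernel/= (_ : _ ^+ 2 + _ = 1 - (r * r') ^+ 2)//.
by rewrite !exprMn !sqr_sqrtr ?sqr_le1//; ring.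
Qed.

Lemma gauss01 A : gauss 0 1 A = N A.
Proof.
rewrite gauss_std; congr (N _).
by apply/seteqP; split => z /=; rewrite add0r mul1r.
Qed.

Lemma gauss_kernel_invariant (r : R) A : `|r| <= 1 -> measurable A ->
  (\int[N]_x gauss_kernel r x A = N A)%E.
Proof.
move=> r1 mA.
transitivity (\int[N]_x gauss (0 + r * x) (Num.sqrt (1 - r ^+ 2)) A)%E.
  by apply: eq_integral => x _; rewrite add0r.
rewrite gauss_mix// sqr_sqrtr ?sqr_le1// addrC subrK sqrtr1; exact: gauss01.
Qed.

Lemma prod_norm_le1 n (rs : 'I_n -> R) : (forall i, `|rs i| <= 1) ->
  `|\prod_(i < n) rs i| <= 1.
Proof.
move=> rs1; rewrite normr_prod.
by apply: prodr_ile1 => i; rewrite normr_ge0 rs1.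
Qed.

Lemma kernel_integral_last n (rs : 'I_n.+1 -> R) (x : R) A :
  (forall i, `|rs i| <= 1) -> measurable A ->
  kernel_integral (fun i => gauss_kernel (rs i)) x (fun v => (\1_A (tnth v ord_max))%:E) =
  gauss_kernel (\prod_(i < n.+1) rs i) x A.
Proof.
elim: n => [|n IH] in rs x *; move=> rs1 mA.
  rewrite big_ord1 /= -[X in gauss_kernel _ _ X]setIT -integral_indic//.
rewrite kernel_integralS big_ord_recl -gauss_kernel_comp//; last exact: prod_norm_le1.
apply: eq_integral => y _; rewrite -IH//.
apply: eq_kernel_integral => v.
by rewrite (_ : ord_max = lift ord0 ord_max) ?tnthS//; exact: val_inj.
Qed.

(** The parameters m and s are fixed before [c] and [x]: the induction applies the remaining chain
    with a constant shifted by a multiple of the point just reached. *)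
Lemma kernel_integral_linear n (rs a : 'I_n -> R) : exists m s : R,
  forall (c x : R) A, measurable A ->
  kernel_integral (fun i => gauss_kernel (rs i)) x
    (fun v => (\1_A (c + \sum_(i < n) a i * tnth v i))%:E) = gauss (c + m * x) s A.
Proof.
elim: n => [|n IH] in rs a *.
  exists 0, 0 => c x A mA /=.
  by rewrite big_ord0 addr0 mul0r addr0 gauss0 /dirac.
have [m [s H]] := IH (fun i => rs (lift ord0 i)) (fun i => a (lift ord0 i)).
(* The first point enters with coefficient [a ord0] directly, and with [m] through the conditional
   mean of the rest. *)
pose b := (a ord0 + m); pose sg := Num.sqrt (1 - rs ord0 ^+ 2).
exists (b * rs ord0), (Num.sqrt ((b * sg) ^+ 2 + s ^+ 2)) => c x A mA.
rewrite kernel_integralS -gauss_mix//.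
transitivity (\int[gauss_kernel (rs ord0) x]_y gauss (c + b * y) s A)%E.
  apply: eq_integral => y _; rewrite (_ : c + b * y = c + a ord0 * y + m * y); last by rewrite /b; ring.
  rewrite -H//; apply: eq_kernel_integral => v.
  rewrite big_ord_recl addrA tnth0; congr (\1_A (_ + _))%:E.
  by apply: eq_bigr => i _; rewrite tnthS.
rewrite integral_gauss_kernel//; last exact: measurable_gauss.
apply: eq_integral => z _.
by rewrite (_ : c + b * (_ + _) = c + b * rs ord0 * x + b * sg * z)// /sg; ring.
Qed.

Variables (n : nat) (rs : 'I_n.+1 -> R) (Ps : 'I_n.+1 -> probability (R * R)%type R).
Hypothesis rs1 : forall i, `|rs i| <= 1.
Hypothesis PsE : forall i A, measurable A -> Ps i A = bigauss (rs i) A.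

Let fst_Ps i A : measurable A -> pushforward (Ps i) fst A = N A.
Proof.
move=> mA; rewrite -(pushforward_fst_bigauss (rs i) mA) /pushforward PsE//.
by rewrite -[X in measurable X]setTI; exact: measurable_fst.
Qed.

Let disintegrates_Ps i : disintegrates (Ps i) (gauss_kernel (rs i)).
Proof.
move=> A mA; rewrite PsE// (disintegrates_bigauss (rs i) mA).
apply: eq_measure_integral => B mB _.
by rewrite [RHS](fst_Ps i mB); exact: pushforward_fst_bigauss.
Qed.

Lemma concatenation_gauss : is_concatenation Ps (chain_law N (fun i => gauss_kernel (rs i))).
Proof.
exists (fun i => gauss_kernel (rs i)); split => // B mB.
by apply: eq_measure_integral => A mA _; exact/esym/fst_Ps.
Qed.

(** The kernels behind [C] are arbitrary versions. They agree with the Gaussian ones almost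
    everywhere for the standard normal law, which is the first marginal of every [Ps i] and is
    preserved by every Gaussian kernel involved. *)
Lemma concatenation_gauss_unique C : is_concatenation Ps C ->
  forall B, measurable B -> C B = chain_law N (fun i => gauss_kernel (rs i)) B.
Proof.
move=> [k [dk CE]] B mB; rewrite CE//.
have ae := @kernel_integral_ae_unique R _ k (fun i => gauss_kernel (rs i)) N
  (fun i => disintegrates_ae_unique (fst_Ps i) (dk i) (disintegrates_Ps i))
  (fun i A mA => gauss_kernel_invariant (rs1 i) mA).
transitivity (\int[N]_x kernel_integral k x (fun v => (\1_B (cons_tuple x v))%:E))%E.
  by apply: eq_measure_integral => A mA _; exact: fst_Ps.
have m1 : measurable_fun setT (fun v : n.+2.-tuple R => (\1_B v : R)%:E).
  exact/measurable_EFinP.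
apply: ge0_ae_eq_integral => //.
- exact: (@measurable_kernel_integral_cons R _ k (fun v => (\1_B v)%:E)).
- exact: (@measurable_kernel_integral_cons R _ (fun i => gauss_kernel (rs i)) (fun v => (\1_B v)%:E)).
- by move=> x _; apply: kernel_integral_ge0.
- by move=> x _; apply: kernel_integral_ge0.
apply: filterS ae => x H _; apply: H => //.
exact: measurableT_comp m1 (@measurable_cons_tuplel R _ x).
Qed.

Let measurable_ends (A : set (R * R)) : measurable A ->
  measurable [set x : n.+2.-tuple R | A (tnth x ord0, tnth x ord_max)].
Proof.
move=> mA; rewrite -[X in measurable X]setTI.
apply: (_ : measurable_fun setT (fun x : n.+2.-tuple R => (tnth x ord0, tnth x ord_max))) => //.
by apply: measurable_fun_pair; exact: measurable_tnth.
Qed.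

Lemma chain_law_ends A : measurable A ->
  chain_law N (fun i => gauss_kernel (rs i)) [set x | A (tnth x ord0, tnth x ord_max)] =
  bigauss (\prod_(i < n.+1) rs i) A.
Proof.
move=> mA; rewrite bigaussE// /chain_law; apply: eq_integral => x _.
rewrite -kernel_integral_last//; last exact: measurable_xsection.
apply: eq_kernel_integral => v; congr EFin.
rewrite !indicE mem_xsection; congr (_%:R); congr nat_of_bool.
apply/idP/idP; rewrite !inE/= (_ : ord_max = lift ord0 ord_max) ?tnthS ?tnth0//; exact: val_inj.
Qed.

Lemma composition_gauss : is_composition Ps (bigauss (\prod_(i < n.+1) rs i)).
Proof.
exists (chain_law N (fun i => gauss_kernel (rs i))); first exact: concatenation_gauss.
by move=> A mA; exact/esym/chain_law_ends.
Qed.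

Lemma composition_gauss_unique Q : is_composition Ps Q ->
  forall A, measurable A -> Q A = bigauss (\prod_(i < n.+1) rs i) A.
Proof.
move=> [C HC QE] A mA.
by rewrite QE// (concatenation_gauss_unique HC) ?chain_law_ends//; exact: measurable_ends.
Qed.

End gauss_chains.

Section markov_gauss.
Context {R : realType}.
Local Notation N := (@std_normal R).

Lemma chain_law_linear n (rs : 'I_n -> R) (b : 'I_n.+1 -> R) : exists s : R,
  forall A, measurable A ->
  chain_law N (fun i => gauss_kernel (rs i))
    [set v | A (\sum_(i < n.+1) b i * tnth v i)] = gauss 0 s A.
Proof.
have [m [s H]] := kernel_integral_linear rs (fun i => b (lift ord0 i)).
exists (Num.sqrt ((b ord0 + m) ^+ 2 + s ^+ 2)) => A mA.
rewrite -gauss_mix// /chain_law; apply: eq_integral => x _.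
rewrite (_ : 0 + (b ord0 + m) * x = b ord0 * x + m * x); last by ring.
rewrite -H//; apply: eq_kernel_integral => v.
congr EFin; rewrite !indicE; congr (_%:R); congr nat_of_bool.
have E : \sum_(i < n.+1) b i * tnth (cons_tuple x v) i =
    b ord0 * x + \sum_(i < n) b (lift ord0 i) * tnth v i.
  rewrite big_ord_recl tnth0; congr (_ + _).
  by apply: eq_bigr => i _; rewrite tnthS.
by apply/idP/idP; rewrite !inE/= E.
Qed.

Lemma tuple_of_size_gt1 (s : seq R) : (1 < size s)%N ->
  exists m (u : m.+2.-tuple R), s = u :> seq R.
Proof.
move=> s2; have H : size s == (size s).-2.+2 by case: s s2 => [|? []].
by exists (size s).-2, (Tuple H).
Qed.

Lemma sorted_nth_lt n (t : n.+2.-tuple R) (i : 'I_n.+1) : sorted <%R t -> t`_i < t`_i.+1.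
Proof. by move=> /(sortedP 0); apply; rewrite size_tuple ltnS. Qed.

Context d (T : measurableType d) (P : probability T R) (Y : R -> {RV P >-> R}).
Variable r : R -> R -> R.
Hypothesis r1 : forall s t, s < t -> `|r s t| <= 1.
Hypothesis rE : forall s t, s < t -> forall A, measurable A ->
  marginal2 (process_law Y) s t A = bigauss (r s t) A.

(** By the Markov property the law at increasing times is a chain of Gaussian kernels, under which
    linear forms are Gaussian. The times in [gaussian_process] come in any order and may repeat, so
    they are sorted without duplicates. *)
Lemma markov_gaussian_process : markov_process Y -> gaussian_process Y.
Proof.
move=> markovY n t a; apply/gaussian_lawP.
(* The times 0 and 1 only ensure that there are at least two times. *)
pose s := sort <=%R (undup ([:: 0; 1] ++ [seq t i | i <- enum 'I_n])).
have s_uniq : uniq s by rewrite sort_uniq undup_uniq.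
have s_sorted : sorted <%R s.
  by rewrite lt_sorted_uniq_le s_uniq sort_le_sorted.
have ts i : t i \in s.
  by rewrite mem_sort mem_undup mem_cat map_f ?orbT// mem_enum.
have s2 : (1 < size s)%N.
  have : {subset [:: 0; 1] <= s}.
    by move=> x x01; rewrite mem_sort mem_undup mem_cat x01.
  by move=> /uniq_leq_size; apply; rewrite /= inE eq_sym oner_eq0.
have [m [u su]] := tuple_of_size_gt1 s2; rewrite {}su in s_uniq s_sorted ts.
(* Collects the coefficients of all indices sharing a time; the sum is empty at an auxiliary time
   that is no [t i]. *)
pose b (j : 'I_m.+2) := \sum_(i < n | t i == tnth u j) a i.
have [sg H] := chain_law_linear (fun i : 'I_m.+1 => r u`_i u`_i.+1) b.
exists 0, sg => A mA; rewrite -H//.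
have mB : measurable [set v : m.+2.-tuple R | A (\sum_(i < m.+2) b i * tnth v i)].
  rewrite -[X in measurable X]setTI.
  apply: (_ : measurable_fun setT (fun v : m.+2.-tuple R => \sum_(i < m.+2) b i * tnth v i)) => //.
  by apply: measurable_sum => i; apply: measurable_funM => //; exact: measurable_tnth.
rewrite -(concatenation_gauss_unique _ _ (markovY _ _ s_sorted) mB); last 2 first.
- by move=> i; apply: r1; exact: sorted_nth_lt.
- by move=> i B mB'; apply: rE => //; exact: sorted_nth_lt.
rewrite /pushforward /marginal /distribution /process_law /distribution /pushforward.
congr (P _); apply/seteqP.
have E w : \sum_(j < m.+2) b j * tnth (coords u (path_of Y w)) j = \sum_(i < n) a i * Y (t i) w.
  under eq_bigr => j _ do rewrite tnth_mktuple /b mulr_suml.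
  rewrite (exchange_big_dep xpredT)//=; apply: eq_bigr => i _.
  have /tnthP[j tj] := ts i.
  rewrite (bigD1 j) ?tj//= big1 ?addr0// => k /andP[/eqP uk kj].
  by case/eqP: kj; have /tuple_uniqP inj := s_uniq; apply: inj; rewrite -uk.
by split => w /=; rewrite E.
Qed.

End markov_gauss.

(** * The process and its transforms *)

Section rotation_process.
Context {R : realType}.
Local Notation N := (@std_normal R).

Definition normal2 : probability (R * R)%type R := (N \x N)%E.
Definition normal3 : probability (R * (R * R))%type R := (N \x normal2)%E.

Lemma normal2E A : normal2 A = (\int[N]_x N (xsection A x))%E.
Proof. by []. Qed.

Lemma normal3E A : normal3 A = (\int[N]_x normal2 (xsection A x))%E.
Proof. by []. Qed.

Opaque normal2 normal3.

Lemma normal2_lin (m a b : R) A : measurable A ->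
  normal2 [set u | A (m + a * u.1 + b * u.2)] = gauss m (Num.sqrt (a ^+ 2 + b ^+ 2)) A.
Proof.
move=> mA; rewrite -gauss_mix// normal2E; apply: eq_integral => x _.
rewrite gauss_std; congr (N _).
by apply/seteqP; split => y /=; rewrite /xsection/= inE.
Qed.

Lemma normal3_lin (a b c : R) A : measurable A ->
  normal3 [set u | A (a * u.1 + b * u.2.1 + c * u.2.2)] =
  gauss 0 (Num.sqrt (a ^+ 2 + b ^+ 2 + c ^+ 2)) A.
Proof.
move=> mA.
have -> : a ^+ 2 + b ^+ 2 + c ^+ 2 = a ^+ 2 + Num.sqrt (b ^+ 2 + c ^+ 2) ^+ 2.
  by rewrite sqr_sqrtr ?addr_ge0 ?sqr_ge0// addrA.
rewrite -gauss_mix// normal3E; apply: eq_integral => x _.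
rewrite -(normal2_lin (0 + a * x) b c mA); congr (normal2 _).
by apply/seteqP; split => y /=; rewrite /xsection/= inE/= add0r.
Qed.

Definition rotate (c s : R) (u : R * R) : R * R :=
  (c * u.1 + s * u.2, - s * u.1 + c * u.2).

Lemma measurable_rotate c s : measurable_fun setT (rotate c s).
Proof.
apply: measurable_fun_pair; apply: measurable_funD; exact: measurable_funM.
Qed.

(** Composing a linear form with a rotation preserves the sum of the squares of its coefficients,
    hence its law. *)
Lemma normal2_rotate (c s : R) A : c ^+ 2 + s ^+ 2 = 1 -> measurable A ->
  normal2 (rotate c s @^-1` A) = normal2 A.
Proof.
move=> cs1 mA.
apply: (cramer_wold_image (measurable_rotate c s)) mA => a b B mB.
have E (a' b' : R) : normal2 [set u | B (a' * u.1 + b' * u.2)] =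
    gauss 0 (Num.sqrt (a' ^+ 2 + b' ^+ 2)) B.
  apply: etrans (normal2_lin 0 a' b' mB); congr (normal2 _).
  by apply/seteqP; split => u /=; rewrite add0r.
have sq : a ^+ 2 + b ^+ 2 = (a * c - b * s) ^+ 2 + (a * s + b * c) ^+ 2.
  by rewrite -[LHS]mulr1 -cs1; ring.
transitivity (normal2 [set u | B ((a * c - b * s) * u.1 + (a * s + b * c) * u.2)]).
  congr (normal2 _).
  by apply/seteqP; split => u /=; congr (B _); rewrite /rotate/=; ring.
by apply: etrans (E _ _) _; rewrite -sq; apply/esym/E.
Qed.

Variable phi : R -> rat.
Hypothesis phiD : forall x y, phi (x + y) = phi x + phi y.

Let angle t : R := ratr (phi t).

Definition rotation_rv (t : R) (u : R * (R * R)) : R :=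
  (Num.sqrt 2)^-1 * (u.1 + cos (ratr (phi t)) * u.2.1 + sin (ratr (phi t)) * u.2.2).

Lemma measurable_rotation_rv t : measurable_fun setT (rotation_rv t).
Proof.
have m2 : measurable_fun setT (fun u : R * (R * R) => u.2) by exact: measurable_snd.
apply: measurable_funM => //; apply: measurable_funD.
  apply: measurable_funD => //; apply: measurable_funM => //.
  exact: measurableT_comp measurable_fst m2.
apply: measurable_funM => //; exact: measurableT_comp measurable_snd m2.
Qed.

HB.instance Definition _ t := isMeasurableFun.Build _ _ _ _ (rotation_rv t) (measurable_rotation_rv t).

Definition rotation_process (t : R) : {RV normal3 >-> R} := rotation_rv t.

Lemma rotation_process_gaussian : gaussian_process rotation_process.
Proof.
move=> n t a; apply/gaussian_lawP.
pose w := (Num.sqrt 2)^-1 : R.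
pose c0 := \sum_(i < n) a i * w.
pose c1 := \sum_(i < n) a i * w * cos (angle (t i)).
pose c2 := \sum_(i < n) a i * w * sin (angle (t i)).
exists 0, (Num.sqrt (c0 ^+ 2 + c1 ^+ 2 + c2 ^+ 2)) => A mA.
apply: etrans (normal3_lin c0 c1 c2 mA); rewrite /pushforward; congr (normal3 _).
have E u : \sum_(i < n) a i * rotation_process (t i) u = c0 * u.1 + c1 * u.2.1 + c2 * u.2.2.
  rewrite /c0 /c1 /c2 !mulr_suml -!big_split; apply: eq_bigr => i _ /=.
  by rewrite /rotation_rv -/w -/(angle _); ring.
by apply/seteqP; split => u /=; rewrite E.
Qed.

Definition rotation_cov (h : R) : R := (1 + cos (ratr (phi h))) / 2.

Lemma rotation_cov_ge0 h : 0 <= rotation_cov h.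
Proof.
have := cos_max (ratr (phi h) : R); rewrite ler_norml => /andP[h1 _].
by rewrite divr_ge0// -lerBlDl sub0r.
Qed.

Lemma rotation_cov_le1 h : rotation_cov h <= 1.
Proof. by rewrite ler_pdivrMr// mul1r; have := cos_le1 (ratr (phi h) : R); lra. Qed.

Lemma phiB x y : phi (x - y) = phi x - phi y.
Proof. by apply/eqP; rewrite eq_sym subr_eq -phiD subrK. Qed.

Lemma rotation_process_marginal2 s t A : measurable A ->
  marginal2 (process_law rotation_process) s t A = bigauss (rotation_cov (t - s)) A.
Proof.
apply: bigauss_unique.
  by rewrite ger0_norm ?rotation_cov_le1// rotation_cov_ge0.
move=> a b {}A mA.
rewrite /marginal2 /process_law /distribution /pushforward.
pose w := (Num.sqrt 2)^-1 : R.
have w2 : w ^+ 2 = 2^-1 by rewrite /w exprVn sqr_sqrtr.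
pose ct := cos (angle t); pose st := sin (angle t).
pose cs := cos (angle s); pose ss := sin (angle s).
(* The variance of a X_s + b X_t as the sum of the squared coefficients of z, x and y. *)
have -> : a ^+ 2 + b ^+ 2 + 2 * a * b * rotation_cov (t - s) =
    (w * (a + b)) ^+ 2 + (w * (a * cs + b * ct)) ^+ 2 + (w * (a * ss + b * st)) ^+ 2.
  rewrite /rotation_cov phiB rmorphB cosB -/(angle t) -/(angle s) -/ct -/st -/cs -/ss.
  rewrite !exprMn w2.
  have cst : st ^+ 2 = 1 - ct ^+ 2 by rewrite -(cos2Dsin2 (angle t)) addrC addKr.
  have css : ss ^+ 2 = 1 - cs ^+ 2 by rewrite -(cos2Dsin2 (angle s)) addrC addKr.
  transitivity (2^-1 * (a + b) ^+ 2 + 2^-1 * (a ^+ 2 * (cs ^+ 2 + ss ^+ 2) +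
    b ^+ 2 * (ct ^+ 2 + st ^+ 2) + 2 * a * b * (ct * cs + st * ss))); last by field.
  by rewrite cst css; field.
apply: etrans (normal3_lin _ _ _ mA); congr (normal3 _).
by apply/seteqP; split => u /=; rewrite /coords2/= /Defs.coord/= /path_of/= /rotation_rv -/w
  -/(angle t) -/(angle s) -/ct -/st -/cs -/ss; congr (A _); ring.
Qed.

(* Shifting the time by [h] rotates the pair (x, y) by the angle [phi h]. *)
Lemma rotation_process_stationary : stationary rotation_process.
Proof.
move=> h A mA.
set c : R := cos (angle h); set s : R := sin (angle h).
pose B := path_of rotation_process @^-1` A.
have mB : measurable B.
  by rewrite -[X in measurable X]setTI; exact: (measurable_path_of rotation_process).
change (normal3 (path_of (fun t => rotation_process (t + h)) @^-1` A) = normal3 B).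
refine (etrans (normal3E _) (etrans _ (esym (normal3E _)))).
apply: eq_integral => x _.
apply: etrans (normal2_rotate (cos2Dsin2 (angle h)) (measurable_xsection x mB)).
congr (normal2 _); apply/seteqP.
have E u : path_of (fun t => rotation_process (t + h)) (x, u) =
    path_of rotation_process (x, rotate c s u).
  apply/funext => t; rewrite /path_of/= /rotation_rv phiD rmorphD cosD sinD /=.
  by rewrite -/(angle t) -/(angle h) -/c -/s; congr (_ * _); ring.
by split => u; rewrite /xsection/= !inE /B/= -[path_of _ (x, rotate _ _ _)]E.
Qed.

End rotation_process.

(** * Products of raised cosines *)

Section raised_cosine.
Context {R : realType}.
Implicit Types x : R.

Lemma normr_sin_le x : `|sin x| <= `|x|.
Proof.
wlog x0 : x / 0 < x.
  move=> H; case: (ltrgt0P x) => [x0|x0|->]; last by rewrite sin0 normr0.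
    by rewrite (le_trans (H _ x0))// gtr0_norm.
  have := H (- x); rewrite sinN !normrN oppr_gt0 => /(_ x0) h.
  by rewrite (le_trans h)// ltr0_norm.
have [|c _] := @MVT R sin cos 0 x x0 (fun y _ => is_derive_sin y).
  by apply: continuous_subspaceT => y; exact: continuous_sin.
rewrite sin0 !subr0 => ->; rewrite normrM -[leRHS]mul1r ler_wpM2r//.
exact: cos_max.
Qed.

(** The left side bounds 1 - sin^2 (x / 2), which is the right side by the half-angle formula. *)
Lemma raised_cos_ge x : 1 - x ^+ 2 / 4 <= (1 + cos x) / 2.
Proof.
have -> : cos x = 1 - 2 * sin (x / 2) ^+ 2.
  rewrite [in LHS](_ : x = x / 2 + x / 2); last by field.
  by rewrite cosD -!expr2; have := cos2Dsin2 (x / 2); lra.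
have : sin (x / 2) ^+ 2 <= (x / 2) ^+ 2.
  rewrite -real_normK ?num_real// -[leRHS]real_normK ?num_real//.
  by rewrite lerXn2r ?nnegrE// normr_sin_le.
by rewrite expr_div_n; lra.
Qed.

Lemma raised_cos_itv x : 0 <= (1 + cos x) / 2 <= 1.
Proof. by have := cos_max x; rewrite ler_norml => /andP[]; lra. Qed.

(** Each factor is at least 1 - C^2 / (4 (n + 1)^2), so by Bernoulli's inequality n + 1 of them lose
    at most C^2 / (4 (n + 1)). [D] depends on n to allow for a varying rational approximation of
    theta. *)
Lemma cvg_raised_cos_expr (D : nat -> R) C : (forall n, `|D n| <= C) ->
  ((1 + cos (D n / n.+1%:R)) / 2) ^+ n.+1 @[n --> \oo] --> (1 : R).
Proof.
move=> DC.
apply: (squeeze_cvgr (f := (fun n => 1 - C ^+ 2 / 4 * n.+1%:R^-1)) (h := (fun=> 1))).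
- apply: nearW => n; have /andP[k0 k1] := raised_cos_itv (D n / n.+1%:R).
  have := raised_cos_ge (D n / n.+1%:R).
  set k := (1 + cos (D n / n.+1%:R)) / 2 in k0 k1 * => kge.
  rewrite exprn_ile1// andbT.
  have -> : k ^+ n.+1 = (1 + (k - 1)) ^+ n.+1 by rewrite addrC subrK.
  apply: le_trans (bernoulli_le _ _); last by rewrite lerBrDr addNr.
  have h : n.+1%:R * (1 - (D n / n.+1%:R) ^+ 2 / 4) <= n.+1%:R * k by rewrite ler_wpM2l.
  have D2 : D n ^+ 2 <= C ^+ 2.
    rewrite -real_normK ?num_real// lerXn2r ?nnegrE//.
    by rewrite (le_trans _ (DC n)).
  have e : n.+1%:R * ((D n / n.+1%:R) ^+ 2 / 4) = D n ^+ 2 / 4 / n.+1%:R by field.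
  have d : D n ^+ 2 / 4 / n.+1%:R <= C ^+ 2 / 4 / n.+1%:R.
    by rewrite ler_wpM2r ?invr_ge0// ler_wpM2r.
  move: h; rewrite mulrBr e mulr1.
  move: d; move: (C ^+ 2 / 4 / _) (D n ^+ 2 / 4 / _) => x y d h.
  by rewrite lerD2l mulrBr mulr1; move: (_ * k) h => z h; lra.
- rewrite -[X in _ --> X]subr0 -(mulr0 (C ^+ 2 / 4)); apply: cvgB; first exact: cvg_cst.
  by apply: cvgM; [exact: cvg_cst|exact: cvg_harmonic].
- exact: cvg_cst.
Qed.

End raised_cosine.

(** * Fine subdivisions with prescribed increments of [phi] *)

Section fine_subdivisions.
Context {R : realType}.
Variable phi : R -> rat.
Hypothesis phiD : forall x y, phi (x + y) = phi x + phi y.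
Hypothesis phi_dense : forall q x y, x < y -> exists2 u, x < u < y & phi u = q.

Local Notation K := (rotation_cov phi).

Variables (a b rho : R).
Hypotheses (ab : a < b) (rho01 : 0 <= rho <= 1).

(** One point is picked in each of the first n + 1 of n + 2 equal subintervals, so that neighbours,
    ends included, are at most two lengths apart. One step carries theta; the n + 1 others share the
    remaining angle equally, in rational quotients that can therefore be prescribed. *)
Let subdivision_step (theta : rat) n : exists t : n.+3.-tuple R,
  [/\ subdivision a b t, mesh t <= 2 * ((b - a) / n.+2%:R) &
   \prod_(i < n.+2) K (t`_i.+1 - t`_i) = (1 + cos (ratr theta)) / 2 *
     ((1 + cos (ratr (phi b - phi a - theta) / n.+1%:R)) / 2) ^+ n.+1].
Proof.
pose D := phi b - phi a - theta.
pose del := (b - a) / n.+2%:R; have del0 : 0 < del by rewrite divr_gt0 ?subr_gt0.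
(* For j = n + 1 this is phi b, so the step ending at [b] is like the previous ones. *)
pose q (j : nat) : rat := phi a + theta + j%:R * (D / n.+1%:R).
have /choice[u uP] (j : nat) : exists u, a + j%:R * del < u < a + j.+1%:R * del /\ phi u = q j.
  have [|u u1 u2] := @phi_dense (q j) (a + j%:R * del) (a + j.+1%:R * del); last by exists u.
  by rewrite ltrD2l ltr_pM2r// ltr_nat.
pose f (i : nat) : R := if i == 0%N then a else if i == n.+2 then b else u i.-1.
have f0 : f 0%N = a by [].
have fn : f n.+2 = b by rewrite /f eqxx.
have fS j : (j <= n)%N -> f j.+1 = u j.
  by move=> jn; rewrite /f/= eqSS ltn_eqF// ltnS.
have bE : b = a + n.+2%:R * del by rewrite /del; field.
have fub i : (i <= n.+2)%N -> f i <= a + i%:R * del.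
  case: i => [|i]; first by rewrite f0 mul0r addr0.
  rewrite ltnS leq_eqVlt => /predU1P[->|]; first by rewrite fn -bE.
  by rewrite ltnS => /fS ->; have [/andP[_ /ltW]] := uP i.
have flb i : (i <= n.+1)%N -> a + i%:R * del <= f i.+1.
  rewrite leq_eqVlt => /predU1P[->|].
    by rewrite fn [leRHS]bE lerD2l ler_pM2r// ler_nat.
  by rewrite ltnS => /fS ->; have [/andP[/ltW]] := uP i.
have flt i : (i <= n.+1)%N -> f i < f i.+1.
  case: i => [_|i]; first by rewrite f0 fS//; have [/andP[+ _] _] := uP 0%N; rewrite mul0r addr0.
  rewrite ltnS => iN; rewrite (fS i)//.
  by have [/andP[_ ui] _] := uP i; exact: lt_le_trans ui (flb i.+1 iN).
have phif i : (i <= n.+1)%N -> phi (f i.+1) = q i.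
  rewrite leq_eqVlt => /predU1P[->|].
    by rewrite fn /q /D mulrCA divff ?mulr1//; ring.
  by rewrite ltnS => /fS ->; have [] := uP i.
pose t : n.+3.-tuple R := [tuple f i | i < n.+3].
have tE i : (i < n.+3)%N -> t`_i = f i.
  by move=> iN; rewrite -[i]/(nat_of_ord (Ordinal iN)) -tnth_nth tnth_mktuple.
exists t; split.
- split.
  + apply/(sortedP 0) => i; rewrite size_tuple => iN.
    by rewrite !tE//; [exact: flt|exact: ltnW].
  + by rewrite tnth_mktuple.
  + by rewrite tnth_mktuple.
- apply: bigmax_le => [|i _]; first by rewrite mulr_ge0// ltW.
  have iN := ltn_ord i; rewrite !tE//; last exact: ltnW.
  rewrite gtr0_norm ?subr_gt0 ?flt// -/del.
  have h1 := fub i.+1 iN.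
  have [i0|i0] := posnP i.
    have h2 : f i = a by rewrite i0.
    by move: h1; rewrite h2 i0 mul1r => h1; rewrite lerBlDl (le_trans h1)// lerD2l mulr2n mulrDl mul1r lerDl ltW.
  have := flb i.-1; rewrite prednK// => /(_ (leq_trans (leq_pred i) (ltnSE iN))).
  move: h1; rewrite -(prednK i0) -!natr1 !mulrDl !mul1r; lra.
- rewrite big_ord_recl; congr (_ * _).
    rewrite !tE// /rotation_cov phiB// phif// f0 /q mul0r addr0.
    by rewrite addrAC subrr add0r.
  rewrite -[RHS](_ : \prod_(i < n.+1) ((1 + cos (ratr D / n.+1%:R)) / 2) = _); last first.
    by rewrite prodr_const card_ord.
  apply: eq_bigr => i _; have iN := ltn_ord i.
  rewrite !tE/= /bump/= ?add1n ?ltnS//; last exact: ltnW.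
  rewrite /rotation_cov phiB// !phif//; last exact: ltnW.
  rewrite (_ : q i.+1 - q i = D / n.+1%:R); last by rewrite /q -natr1; ring.
  by rewrite fmorph_div rmorph_nat.
Qed.

Lemma fine_subdivisions : exists (m : nat -> nat) (t : forall n, (m n).+2.-tuple R),
  [/\ forall n, subdivision a b (t n),
      (fun n => mesh (t n)) @ \oo --> (0 : R) &
      (fun n => \prod_(i < (m n).+1) K ((t n)`_i.+1 - (t n)`_i)) @ \oo --> rho].
Proof.
(* The solution of (1 + cos theta) / 2 = rho, approximated by rationals because [phi] takes rational
   values. *)
pose theta := acos (2 * rho - 1).
have cos_theta : cos theta = 2 * rho - 1.
  by rewrite acosK// in_itv/=; move: rho01 => /andP[]; lra.
have /choice[th thP] (n : nat) : exists q : rat, theta < ratr q < theta + n.+1%:R^-1.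
  have /rat_in_itvoo[q] : theta < theta + n.+1%:R^-1 by rewrite ltrDl invr_gt0.
  by rewrite in_itv/=; exists q.
have th_cvg : (ratr (th n) : R) @[n --> \oo] --> theta.
  apply: (squeeze_cvgr (f := (fun=> theta)) (h := (fun n => theta + n.+1%:R^-1))).
  - by apply: nearW => n; have /andP[/ltW -> /ltW ->] := thP n.
  - exact: cvg_cst.
  - by rewrite -[X in _ --> X]addr0; apply: cvgD; [exact: cvg_cst|exact: cvg_harmonic].
pose t n := projT1 (cid (subdivision_step (th n) n)).
have tP n : [/\ subdivision a b (t n), mesh (t n) <= 2 * ((b - a) / n.+2%:R) & _] :=
  projT2 (cid (subdivision_step (th n) n)).
exists (fun n => n.+1), t; split.
- by move=> n; have [] := tP n.
- apply: (squeeze_cvgr (f := (fun=> 0)) (h := (fun n => 2 * (b - a) * n.+1%:R^-1))).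
  + apply: nearW => n; have [_ h _] := tP n; rewrite bigmax_ge_id/=.
    have ba : 0 <= 2 * (b - a) by rewrite mulr_ge0// subr_ge0 ltW.
    by rewrite (le_trans h)// mulrA ler_wpM2l// lef_pV2 ?posrE// ler_nat.
  + exact: cvg_cst.
  + rewrite -(mulr0 (2 * (b - a))); apply: cvgM; [exact: cvg_cst|exact: cvg_harmonic].
- rewrite (_ : (fun n => _) = (fun n => (1 + cos (ratr (th n))) / 2 *
    ((1 + cos (ratr (phi b - phi a - th n) / n.+1%:R)) / 2) ^+ n.+1)); last first.
    by apply/funext => n; have [_ _ ->] := tP n.
  rewrite -[X in _ --> X]mulr1; apply: cvgM.
    rewrite (_ : rho = (1 + cos theta) / 2); last by rewrite cos_theta; field.
    apply: cvgM; last exact: cvg_cst.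
    apply: cvgD; first exact: cvg_cst.
    by apply: (cvg_comp _ cos); [exact: th_cvg|exact: continuous_cos].
  (* As [th n] lies within 1 of theta, the angle left to the small steps is bounded uniformly in
     n. *)
  apply: (@cvg_raised_cos_expr R (fun n => ratr (phi b - phi a - th n))
    (`|ratr (phi b - phi a)| + (`|theta| + 1))) => n.
  rewrite rmorphB (le_trans (ler_normB _ _))// lerD2l.
  rewrite -[X in `|X|](subrK theta) addrC (le_trans (ler_normD _ _))// lerD2l.
  have /andP[h1 h2] := thP n; rewrite gtr0_norm ?subr_gt0// lerBlDl (le_trans (ltW h2))//.
  by rewrite lerD2l invf_le1// ler1n.
Qed.

End fine_subdivisions.

(** * Gaussian pairs and their covariance *)

Section gaussian_pairs.
Context {R : realType} d (T : measurableType d) (P : probability T R).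
Implicit Types U V : {RV P >-> R}.

Lemma lin_comb_rv U V (a b : R) : exists W : {RV P >-> R},
  (W : T -> R) = (fun w => a * U w + b * V w).
Proof.
have mW : measurable_fun setT (fun w => a * U w + b * V w).
  by apply: measurable_funD; apply: measurable_funM => //; exact: measurable_funPT.
pose W : {mfun T >-> R} := HB.pack (fun w => a * U w + b * V w)
  (isMeasurableFun.Build _ _ _ _ _ mW).
by exists W.
Qed.

Lemma expectation_variance_lin_comb (U V : T -> R) (a b c : R) :
  U \in Lfun P 2%:E -> V \in Lfun P 2%:E ->
  ('E_P[U] = 0 -> 'E_P[V] = 0 -> 'V_P[U] = 1 -> 'V_P[V] = 1 -> covariance P U V = c%:E ->
  'E_P[(fun w => a * U w + b * V w)%R] = 0 /\
  'V_P[(fun w => a * U w + b * V w)%R] = (a ^+ 2 + b ^+ 2 + 2 * a * b * c)%R%:E)%E.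
Proof.
move=> U2 V2 EU EV VU VV UV.
have Pfin : P setT \is a fin_num := fin_num_measure P _ measurableT.
have U1 := Lfun_subset12 Pfin U2; have V1 := Lfun_subset12 Pfin V2.
have aU2 : (a \o* U) \in Lfun P 2%:E by rewrite Lfun_scale// ler1n.
have bV2 : (b \o* V) \in Lfun P 2%:E by rewrite Lfun_scale// ler1n.
have aU1 := Lfun_subset12 Pfin aU2; have bV1 := Lfun_subset12 Pfin bV2.
have -> : (fun w => a * U w + b * V w) = (a \o* U \+ b \o* V)%R.
  by apply/funext => w /=; rewrite mulrC (mulrC b).
split; first by rewrite expectationD// !expectationZl// EU EV !mule0 adde0.
rewrite varianceD// !varianceZ// VU VV !mule1.
rewrite covarianceZl//; last by rewrite Lfun2_mul_Lfun1.
rewrite covarianceZr// ?Lfun2_mul_Lfun1// UV -!EFinM -!EFinD.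
by congr EFin; ring.
Qed.

Section process_marginals.
Variable Y : R -> {RV P >-> R}.

Lemma marginal2_lin (s t a b : R) (A : set R) :
  marginal2 (process_law Y) s t ((fun u => a * u.1 + b * u.2) @^-1` A) =
  P [set w | A (a * Y s w + b * Y t w)].
Proof. by []. Qed.

Lemma bigauss_marginal2_law (s t c : R) : `|c| <= 1 ->
  (forall A, measurable A -> marginal2 (process_law Y) s t A = bigauss c A) ->
  forall (a b : R) A, measurable A ->
  P [set w | A (a * Y s w + b * Y t w)] =
  gauss 0 (Num.sqrt (a ^+ 2 + b ^+ 2 + 2 * a * b * c)) A.
Proof.
move=> c1 YE a b A mA.
apply: etrans (bigauss_lin a b c1 mA).
apply: etrans (YE _ _); first exact/esym/marginal2_lin.
rewrite -[X in measurable X]setTI.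
apply: (_ : measurable_fun setT (fun u : R * R => a * u.1 + b * u.2)) => //.
by apply: measurable_funD; apply: measurable_funM.
Qed.

(** The covariance is read off from the variance of Y_s + Y_t, computed both from its law, as 2 + 2
    c, and by bilinearity. *)
Lemma bigauss_marginal2_moments (s t c : R) : `|c| <= 1 ->
  (forall A, measurable A -> marginal2 (process_law Y) s t A = bigauss c A) ->
  [/\ 'E_P[Y s] = 0, 'V_P[Y s] = 1 & covariance P (Y s) (Y t) = c%:E]%E.
Proof.
move=> c1 YE; have law := bigauss_marginal2_law c1 YE.
have lawS A : measurable A -> P (Y s @^-1` A) = gauss 0 1 A.
  move=> mA; have := law 1 0 A mA.
  rewrite expr1n expr0n !mulr0 mul0r !addr0 sqrtr1 => <-; congr (P _).
  by apply/seteqP; split => w /=; rewrite mul1r mul0r addr0.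
have lawT A : measurable A -> P (Y t @^-1` A) = gauss 0 1 A.
  move=> mA; have := law 0 1 A mA.
  rewrite expr1n expr0n !mulr0 !mul0r add0r !addr0 sqrtr1 => <-; congr (P _).
  by apply/seteqP; split => w /=; rewrite mul1r mul0r add0r.
have s2 := gauss_Lfun2 lawS; have t2 := gauss_Lfun2 lawT.
have Pfin : P setT \is a fin_num := fin_num_measure P _ measurableT.
have s1 := Lfun_subset12 Pfin s2; have t1 := Lfun_subset12 Pfin t2.
have VS : ('V_P[Y s] = 1)%E by rewrite (gauss_variance lawS) expr1n.
have VT : ('V_P[Y t] = 1)%E by rewrite (gauss_variance lawT) expr1n.
split => //; first exact: gauss_expectation lawS.
have [W WE] := lin_comb_rv (Y s) (Y t) 1 1.
have lawW A : measurable A -> P (W @^-1` A) = gauss 0 (Num.sqrt (2 + 2 * c)) A.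
  move=> mA; rewrite WE; apply: etrans (law 1 1 A mA) _.
  by rewrite expr1n !mulr1.
have fincov : covariance P (Y s) (Y t) \is a fin_num.
  by apply: covariance_fin_num => //; exact: Lfun2_mul_Lfun1.
have := gauss_variance lawW.
rewrite WE (_ : (fun w => _) = (Y s : T -> R) \+ Y t); last first.
  by apply/funext => w /=; rewrite !mul1r.
rewrite varianceD// VS VT sqr_sqrtr; last first.
  by move: c1; rewrite ler_norml => /andP[]; lra.
rewrite -(fineK fincov) -EFinM -!EFinD => -[h]; congr EFin.
by move: h; move: (fine _) => z; lra.
Qed.

Hypothesis gaussY : gaussian_process Y.
Hypothesis momentsY : forall t, ('E_P[Y t] = 0 /\ 'V_P[Y t] = 1)%E.

Lemma gaussian_process_Lfun2 t : (Y t : T -> R) \in Lfun P 2%:E.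
Proof.
have /gaussian_lawP[m [s law]] := gaussY (fun=> t : R) (fun=> 1 : R) (n := 1).
apply: (@gauss_Lfun2 _ _ _ P (Y t) m s) => A mA; rewrite -law// /pushforward.
by congr (P _); apply/seteqP; split => w /=; rewrite big_ord1 mul1r.
Qed.

Lemma gaussian_covariance_fin_num s t : covariance P (Y s) (Y t) \is a fin_num.
Proof.
have Pfin : P setT \is a fin_num := fin_num_measure P _ measurableT.
have s2 := gaussian_process_Lfun2 s; have t2 := gaussian_process_Lfun2 t.
by apply: covariance_fin_num; [exact: Lfun_subset12|exact: Lfun_subset12|exact: Lfun2_mul_Lfun1].
Qed.

(** The variances of Y_s + Y_t and Y_s - Y_t are nonnegative. *)
Lemma gaussian_covariance_le1 s t : `|fine (covariance P (Y s) (Y t))| <= 1.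
Proof.
have s2 := gaussian_process_Lfun2 s; have t2 := gaussian_process_Lfun2 t.
have [[ES VS] [ET VT]] := (momentsY s, momentsY t).
have H (a b : R) := expectation_variance_lin_comb a b s2 t2 ES ET VS VT
  (esym (fineK (gaussian_covariance_fin_num s t))).
have H1 : 0 <= 1 ^+ 2 + 1 ^+ 2 + 2 * 1 * 1 * fine (covariance P (Y s) (Y t)).
  by rewrite -lee_fin -(H 1 1).2 variance_ge0.
have H2 : 0 <= 1 ^+ 2 + (- 1) ^+ 2 + 2 * 1 * (- 1) * fine (covariance P (Y s) (Y t)).
  by rewrite -lee_fin -(H 1 (-1)).2 variance_ge0.
by rewrite ler_norml; apply/andP; split; lra.
Qed.

(** A linear combination of Y_s and Y_t is Gaussian with unknown parameters, which its expectation
    and variance identify, the deviation up to a sign that [gauss_sqr] removes. *)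
Lemma gaussian_marginal2 s t A : measurable A ->
  marginal2 (process_law Y) s t A = bigauss (fine (covariance P (Y s) (Y t))) A.
Proof.
apply: bigauss_unique; first exact: gaussian_covariance_le1.
move=> a b {}A mA; rewrite marginal2_lin.
have s2 := gaussian_process_Lfun2 s; have t2 := gaussian_process_Lfun2 t.
have [[ES VS] [ET VT]] := (momentsY s, momentsY t).
have [EW VW] := expectation_variance_lin_comb a b s2 t2 ES ET VS VT
  (esym (fineK (gaussian_covariance_fin_num s t))).
have [W WE] := lin_comb_rv (Y s) (Y t) a b; rewrite -WE in EW VW.
have /gaussian_lawP[m [sg law]] := gaussY (fun i : 'I_2 => if i == ord0 then s else t)
  (fun i => if i == ord0 then a else b).
have lawW B : measurable B -> P (W @^-1` B) = gauss m sg B.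
  move=> mB; rewrite -law// /pushforward WE; congr (P _).
  by apply/seteqP; split => w /=; rewrite big_ord_recl big_ord1.
have := gauss_expectation lawW; rewrite EW => -[m0].
have := gauss_variance lawW; rewrite VW => -[sg2].
rewrite -m0 in lawW.
have -> : [set w | A (a * Y s w + b * Y t w)] = W @^-1` A by rewrite WE.
rewrite lawW//; apply: gauss_sqr => //.
by rewrite -[LHS]sg2 sqr_sqrtr// sg2 sqr_ge0.
Qed.

End process_marginals.

End gaussian_pairs.

(** * Characterisation of the transforms *)

Section transforms.
Context {R : realType}.
Variable phi : R -> rat.
Hypothesis phiD : forall x y, phi (x + y) = phi x + phi y.
Hypothesis phi_dense : forall q x y, x < y -> exists2 u, x < u < y & phi u = q.
Context d (T : measurableType d) (P : probability T R) (Y : R -> {RV P >-> R}).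

Local Notation K := (rotation_cov phi).
Local Notation X := (rotation_process phi).

Lemma rotation_cov_norm_le1 h : `|K h| <= 1.
Proof. by rewrite ger0_norm ?rotation_cov_le1// rotation_cov_ge0. Qed.

Lemma prod_rotation_cov01 n (h : 'I_n -> R) : 0 <= \prod_(i < n) K (h i) <= 1.
Proof.
rewrite prodr_ge0 => [|i _]; last exact: rotation_cov_ge0.
by apply: prodr_ile1 => i _; rewrite rotation_cov_ge0 rotation_cov_le1.
Qed.

Lemma successive_rotation_marginals n (t : n.+2.-tuple R) i A : measurable A ->
  successive_marginals (process_law X) t i A = bigauss (K (t`_i.+1 - t`_i)) A.
Proof. exact: rotation_process_marginal2. Qed.

(** Compactness of [0, 1]: the correlations converge along a subsequence, whose laws then tend to a
    Gaussian one. The weak limit of the whole sequence must coincide with it. *)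
Lemma weak_limit_bigauss (Q_ : nat -> probability (R * R)%type R) (rs : nat -> R) Q :
  (forall n, 0 <= rs n <= 1) ->
  (forall n A, measurable A -> Q_ n A = bigauss (rs n) A) -> weak_cvg Q_ Q ->
  exists2 r, 0 <= r <= 1 & forall A, measurable A -> Q A = bigauss r A.
Proof.
move=> rs01 Q_E Q_Q.
have bnd : bounded_fun rs.
  exists 1; split; first exact: num_real.
  move=> x x1 n _ /=; have /andP[r0 r1] := rs01 n.
  by rewrite ger0_norm// (le_trans r1)// ltW.
have [f f_incr /cvg_ex[r fr]] := bolzano_weierstrass bnd.
have f_oo : f @ \oo --> \oo.
  have f_ge n : (n <= f n)%N.
    by elim: n => // n IH; exact: leq_ltn_trans IH ((increasing_seqP f).2 f_incr n).
  by apply/cvgnyPge => A; near=> n; apply: leq_trans (f_ge n); near: n; exact: nbhs_infty_ge.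
exists r.
  rewrite -(cvg_lim (@Rhausdorff R) fr).
  apply/andP; split; [apply: limr_ge|apply: limr_le]; try (by apply/cvg_ex; exists r);
    by apply: nearW => n; have /andP[] := rs01 (f n).
apply: bigauss_limit => g cg bg.
have QE n : (\int[Q_ (f n)]_x (g x)%:E = \int[bigauss (rs (f n))]_x (g x)%:E)%E.
  by apply: eq_measure_integral => A mA _; exact: Q_E.
have : ((fun n => \int[Q_ (f n)]_x (g x)%:E) @ \oo --> \int[bigauss r]_x (g x)%:E)%E.
  by under eq_fun do rewrite QE; exact: bigauss_cvg fr cg bg.
apply: cvg_unique; [exact: ereal_hausdorff|exact: cvg_comp f_oo (Q_Q g cg bg)].
Unshelve. all: by end_near. Qed.

Lemma transform_marginal2 :
  weak_local_markov_transform (process_law X) (process_law Y) ->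
  forall a b, a < b -> exists2 r, 0 <= r <= 1 &
  forall A, measurable A -> marginal2 (process_law Y) a b A = bigauss r A.
Proof.
move=> [_ wlmt] a b ab; have [m [t [Q [_ _ compQ cvgQ]]]] := wlmt a b ab.
apply: (weak_limit_bigauss (rs := fun n => \prod_(i < (m n).+1) K ((t n)`_i.+1 - (t n)`_i)) _ _ cvgQ).
  by move=> n; exact: prod_rotation_cov01.
move=> n; apply: composition_gauss_unique (compQ n).
  by move=> i; exact: rotation_cov_norm_le1.
exact: successive_rotation_marginals.
Qed.

(** In the direct sense the pair laws are known for s < t only; symmetry and the variance supply the
    other covariances. Conversely, the correlation of Y_a and Y_b lies in [0, 1], and
    [fine_subdivisions] reaches it. *)
Lemma weak_local_markov_transformP :
  weak_local_markov_transform (process_law X) (process_law Y) <->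
  [/\ gaussian_process Y /\ (forall t, 'E_P[Y t] = 0 /\ 'V_P[Y t] = 1)%E,
      (forall s t, (0 <= covariance P (Y s) (Y t))%E) & markov_process Y].
Proof.
split => [wlmt|[[gaussY momentsY] cov0 markovY]].
  have markovY : markov_process Y by case: wlmt.
  have /choice[r rP] (u : R * R) : exists r : R, u.1 < u.2 -> 0 <= r <= 1 /\
      forall A, measurable A -> marginal2 (process_law Y) u.1 u.2 A = bigauss r A.
    have [u12|u12] := ltP u.1 u.2; last by exists 0.
    by have [r r01 rE] := transform_marginal2 wlmt u12; exists r.
  have r1 s t : s < t -> `|r (s, t)| <= 1.
    by move=> /(rP (s, t))[/andP[r0 r1] _]; rewrite ger0_norm.
  have rE s t : s < t -> forall A, measurable A ->
      marginal2 (process_law Y) s t A = bigauss (r (s, t)) A.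
    by move=> /(rP (s, t))[].
  have moments s t (st : s < t) := bigauss_marginal2_moments (r1 s t st) (rE s t st).
  (* Any later time, here t + 1, gives access to the law of Y_t. *)
  have momentsY t : ('E_P[Y t] = 0 /\ 'V_P[Y t] = 1)%E.
    by have [] := moments t (t + 1) _; rewrite ?ltrDl.
  split => //.
    split => //; exact: (markov_gaussian_process (r := fun s t => r (s, t))).
  have cov0 s t : s < t -> (0 <= covariance P (Y s) (Y t))%E.
    move=> st; have [_ _ ->] := moments s t st.
    by have [/andP[r0 _] _] := rP (s, t) st.
  move=> s t; have [/cov0//|ts|->] := ltgtP s t.
    by rewrite covarianceC; exact: cov0.
  by rewrite -[covariance _ _ _]/('V_P[Y t])%E (momentsY t).2.
split => // a b ab.
set c := fine (covariance P (Y a) (Y b)).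
have c01 : 0 <= c <= 1.
  rewrite fine_ge0//; have := gaussian_covariance_le1 gaussY momentsY a b.
  by rewrite ler_norml => /andP[].
have [m [t [subt mesht prodt]]] := fine_subdivisions phiD phi_dense ab c01.
exists m, t, (fun n => bigauss (\prod_(i < (m n).+1) K ((t n)`_i.+1 - (t n)`_i))).
split => // [n|f cf bf].
  apply: composition_gauss.
    by move=> i; exact: rotation_cov_norm_le1.
  exact: successive_rotation_marginals.
rewrite (_ : (\int[marginal2 _ a b]_x (f x)%:E)%E = \int[bigauss c]_x (f x)%:E)%E.
  exact: bigauss_cvg.
by apply: eq_measure_integral => A mA _; exact: gaussian_marginal2.
Qed.

End transforms.

Theorem theorem2 (R : realType) :
  exists (d : measure_display) (T : measurableType d) (P : probability T R)
         (X : R -> {RV P >-> R}),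
    [/\ gaussian_process X, stationary X &
      forall (d' : measure_display) (T' : measurableType d')
             (P' : probability T' R) (Y : R -> {RV P' >-> R}),
        weak_local_markov_transform (process_law X) (process_law Y) <->
        [/\ gaussian_process Y /\
              (forall t, 'E_P'[Y t] = 0 /\ 'V_P'[Y t] = 1)%E,
            (forall s t, (0 <= covariance P' (Y s) (Y t))%E) &
            markov_process Y]].
Proof.
have [phi [phiD phi_dense]] := additive_dense_fibers R.
exists _, (R * (R * R))%type, normal3, (rotation_process phi).
split; [exact: rotation_process_gaussian|exact: rotation_process_stationary|].
by move=> d' T' P' Y; exact: weak_local_markov_transformP.
Qed.
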